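(* The following decision problem is coNP-complete: given $n$ and a (rational) point $x\in\mathbb{R}^{n^2\times n^2}$ (i.e. $x\in\mathbb{R}^{n^4}$) with $x\geqslant 0$, decide whether $x$ satisfies every inequality of the form $$(\beta-1)\sum_{(ij)\in P\times Q}Y_{ij,ij}-\sum_{\substack{(ij),(kl)\in P\times Q\\ i<k}}Y_{ij,kl}\leqslant\frac{\beta^2-\beta}{2},$$ where $P,Q\subset[n]$ and the integer $\beta$ satisfy (i) $\beta+1\leqslant|P|,|Q|\leqslant n-3$, (ii) $|P|+|Q|\leqslant n-3+\beta$, (iii) $\beta\geqslant 2$.
   Context: Points $Y\in\mathbb{R}^{n^2\times n^2}$ have rows and columns indexed by pairs $(ij)$ with $i,j\in[n]$; $Y_{ij,kl}$ is the entry in row $(ij)$ and column $(kl)$. *)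

(* Defs.v *)
From HB Require Import structures.
From mathcomp Require Import all_boot all_order all_algebra.

Set Implicit Arguments.
Unset Strict Implicit.
Unset Printing Implicit Defensive.

Import Order.TTheory GRing.Theory Num.Theory.

Local Open Scope nat_scope.

(* Deterministic multi-tape Turing machines over an arbitrary finite tape     *)
(* alphabet containing the two input bits and the blank [None].               *)

Definition symbol (E : finType) : Type := option (bool + E).

Inductive move := MoveLeft | MoveRight | Stay.

(* There are [tm_work.+1] tapes, tape [ord0] carrying the input and the       *)
(* output.                                                                    *)
Record tm := TM {
  tm_work : nat;
  tm_state : finType;
  tm_extra : finType;
  tm_start : tm_state;
  tm_halt : pred tm_state;
  tm_delta : tm_state -> {ffun 'I_tm_work.+1 -> symbol tm_extra} ->
             tm_state * ('I_tm_work.+1 -> symbol tm_extra * move)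
}.

(* A two-way infinite tape: the cells left of the head (nearest first), and   *)
(* the scanned cell followed by the cells to its right; every cell that is    *)
(* not listed is blank.                                                       *)
Record tape (E : finType) := Tape {
  tape_left : seq (symbol E);
  tape_right : seq (symbol E)
}.

Definition tape_read (E : finType) (t : tape E) : symbol E :=
  head None (tape_right t).

Definition tape_write (E : finType) (t : tape E) (a : symbol E) : tape E :=
  Tape (tape_left t) (a :: behead (tape_right t)).

Definition tape_move (E : finType) (t : tape E) (d : move) : tape E :=
  match d with
  | MoveLeft =>
      Tape (behead (tape_left t)) (head None (tape_left t) :: tape_right t)
  | MoveRight =>
      Tape (tape_read t :: tape_left t) (behead (tape_right t))
  | Stay => t
  end.

Definition config (M : tm) : Type :=
  (tm_state M * ('I_(tm_work M).+1 -> tape (tm_extra M)))%type.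

Definition tm_init (M : tm) (w : seq bool) : config M :=
  (tm_start M,
   fun i => Tape [::] (if i == ord0 then [seq Some (inl b) | b <- w]
                       else [::])).

(* Halting configurations are fixed points of [tm_step].                      *)
Definition tm_step (M : tm) (c : config M) : config M :=
  if tm_halt c.1 then c else
  let r := tm_delta c.1 [ffun i => tape_read (c.2 i)] in
  (r.1, fun i => tape_move (tape_write (c.2 i) (r.2 i).1) (r.2 i).2).

Fixpoint leading_bits (E : finType) (s : seq (symbol E)) : seq bool :=
  if s is Some (inl b) :: s' then b :: leading_bits s' else [::].

(* The output is the longest word of bits starting at the head of tape        *)
(* [ord0].                                                                    *)
Definition tm_output (M : tm) (c : config M) : seq bool :=
  leading_bits (tape_right (c.2 ord0)).

Definition polytime (f : seq bool -> seq bool) : Prop :=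
  exists (M : tm) (p : {poly nat}), forall w : seq bool,
    let c := iter p.[size w]%R (@tm_step M) (tm_init M w) in
    tm_halt c.1 /\ tm_output c = f w.

Definition language := seq bool -> Prop.

(* Self-delimiting form of a word, so that [delimit x ++ u] encodes the pair  *)
(* of words [(x, u)].                                                         *)
Definition delimit (s : seq bool) : seq bool :=
  flatten [seq [:: true; b] | b <- s] ++ [:: false].

Definition in_NP (L : language) : Prop :=
  exists (V : pred (seq bool)) (q : {poly nat}),
    polytime (fun w => [:: V w]) /\
    forall x : seq bool,
      L x <-> exists u : seq bool, size u <= q.[size x]%R /\ V (delimit x ++ u).

Definition in_coNP (L : language) : Prop := in_NP (fun w => ~ L w).

Definition karp_reducible (L1 L2 : language) : Prop :=
  exists f : seq bool -> seq bool,
    polytime f /\ forall w : seq bool, L1 w <-> L2 (f w).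

Definition coNP_complete (L : language) : Prop :=
  in_coNP L /\ forall L' : language, in_coNP L' -> karp_reducible L' L.

Definition point (R : Type) (n : nat) : Type :=
  'I_n * 'I_n -> 'I_n * 'I_n -> R.

Definition admissible (n : nat) (P Q : {set 'I_n}) (beta : nat) : Prop :=
  [/\ beta + 1 <= #|P| /\ beta + 1 <= #|Q|,
      #|P| + 3 <= n /\ #|Q| + 3 <= n,
      #|P| + #|Q| + 3 <= n + beta
    & 2 <= beta].

Definition PQ_inequality (n : nat) (P Q : {set 'I_n}) (beta : nat)
    (Y : point rat n) : Prop :=
  ((beta%:R - 1) * (\sum_(p in setX P Q) Y p p)
   - \sum_(p in setX P Q) \sum_(q in setX P Q | (p.1 < q.1)%N) Y p q
   <= (beta%:R ^+ 2 - beta%:R) / 2%:R)%R.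

(* Binary digits without leading zeros, least significant first.              *)
Definition bits (m : nat) : seq bool :=
  mkseq (fun i => odd (m %/ 2 ^ i)) (up_log 2 m.+1).

Definition encode_nat (m : nat) : seq bool := delimit (bits m).

Definition encode_int (z : int) : seq bool :=
  (z < 0)%R :: encode_nat `|z|%N.

Definition row_major (n : nat) : seq ('I_n * 'I_n) :=
  [seq (i, j) | i <- enum 'I_n, j <- enum 'I_n].

(* A rational point is given by the numerators and (positive) denominators of *)
(* all its n ^ 4 entries, in binary; the fractions need not be in lowest      *)
(* terms.                                                                     *)
Definition encode_point (n : nat) (num : point int n) (den : point nat n) :
    seq bool :=
  encode_nat n ++
  flatten [seq encode_int (num p q) ++ encode_nat (den p q)
          | p <- row_major n, q <- row_major n].

Definition fraction_point (n : nat) (num : point int n) (den : point nat n) :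
    point rat n :=
  fun p q => ((num p q)%:~R / (den p q)%:R)%R.

(* Words that do not encode a nonnegative rational point are not in the       *)
(* language.                                                                  *)
Definition PQ_language : language := fun w =>
  exists (n : nat) (num : point int n) (den : point nat n),
    [/\ w = encode_point num den,
        forall p q, 0 < den p q,
        forall p q, (0 <= fraction_point num den p q)%R
      & forall (P Q : {set 'I_n}) (beta : nat),
          admissible P Q beta -> PQ_inequality P Q beta (fraction_point num den)].

(* Main.v *)
(* Polynomial time.  A program over four stacks of bits is simulated by a      *)
(* Turing machine that keeps each stack to the right of a head.  Data are      *)
(* binary trees in prefix code, so values can be piled up on one stack and     *)
(* pairing costs one push; the functions computed by such programs are closed  *)
(* under composition, pairing, case analysis and iteration as long as all      *)
(* intermediate results have polynomial size.                                  *)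
(*                                                                             *)
(* Membership.  The certificate of a violated inequality is (P, Q, beta); the  *)
(* verifier decodes the word, re-encodes it to detect ill-formed words, and    *)
(* compares the two sides over a common denominator.                           *)
(*                                                                             *)
(* Hardness.  An accepting run of a verifier is a consistent choice of one     *)
(* tile for each cell of a space-time diagram, i.e. an independent set of K    *)
(* vertices in the graph of conflicting tiles.  Give vertex i the weight       *)
(* Y_(i0,i0) = 1/(K-1) and every conflict i < k the weight Y_(i0,k0) =         *)
(* n^2/(K-1).  A conflict inside P outweighs every gain, so the inequality of  *)
(* (P, Q, beta) can only fail for P independent with |P|/(K-1) > beta/2 >= 1;  *)
(* conversely an independent P with |P| >= K violates it with beta = 2 and any *)
(* three-element Q containing 0.                                               *)

Require Import Defs.
From mathcomp Require Import all_boot all_order all_algebra.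
From mathcomp Require Import zify ring.
From Stdlib Require Import Classical.

Set Implicit Arguments.
Unset Strict Implicit.
Unset Printing Implicit Defensive.

Import Order.TTheory GRing.Theory Num.Theory.

Local Open Scope nat_scope.

(** * Stack programs and their Turing machines *)

(** Membership in coNP. A nonnegative point outside the language violates the inequality of some (P,
    Q, beta), and this triple is a short certificate: two indicator words of length n, and beta in
    unary, as beta is less than n. Both sums are computed as unreduced fractions whose lengths stay
    linear in the length of the input, so the check takes polynomial time. A word that encodes no
    nonnegative point is accepted with any certificate. See [verify_sound], [violation_not_PQ] and
    [PQ_in_coNP].

    Hardness. Let the complement of L be verified by a machine M with certificates of length at most
    Q, and fix an input w. With a time bound T, the runs of M on w and a certificate are the tilings
    of a space-time diagram subject to local constraints, and an accepting certificate exists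
    exactly when a tiling does ([tableauP]). Take as vertices the pairs of a cell and a tile allowed
    in it, and join incompatible pairs; different tiles in one cell are incompatible. A tiling is
    then an independent set whose size is the number K of cells ([independent_satisfies]).

    The point attached to this graph vanishes outside the entries whose two second indices are 0. If
    0 is not in Q, the left side of the inequality is 0 and nothing is violated. Otherwise the
    inequality says that (beta-1) a/(K-1) - c n^2/(K-1) is at most beta(beta-1)/2, where P contains
    a vertices and c conflicts. As (beta-1) a is at most n^2, a violation forces c = 0 and 2a >
    beta(K-1), hence a is at least K. Conversely an independent set of size at least K, taken as P,
    violates the inequality for beta = 2 ([graph_reduction]). So w is in L exactly when its image is
    in the language ([reductionP]).

    Both halves need explicit polynomial-time functions. These are written as programs on stacks,
    which [exec_run] turns into Turing machines; [polyf] is closed under the usual list operations,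
    and [polyf_polytime] converts it into [polytime]. *)

Definition reg := 'I_4.
Definition RS : reg := @Ordinal 4 0 isT.
Definition RA : reg := @Ordinal 4 1 isT.
Definition RB : reg := @Ordinal 4 2 isT.
Definition RC : reg := @Ordinal 4 3 isT.

Inductive store := Store of seq bool & seq bool & seq bool & seq bool.

Definition get (s : store) (r : reg) : seq bool :=
  let: Store a b c d := s in nth [::] [:: a; b; c; d] r.

Definition set_reg (s : store) (r : reg) (x : seq bool) : store :=
  let: Store a b c d := s in
  match val r with
  | 0 => Store x b c d
  | 1 => Store a x c d
  | 2 => Store a b x d
  | _ => Store a b c x
  end.

Lemma get_set_reg s r x r' :
  get (set_reg s r x) r' = if r' == r then x else get s r'.
Proof.
case: s => a b c d; rewrite -val_eqE.
by case: r => -[|[|[|[|//]]]] ?; case: r' => -[|[|[|[|//]]]] ?.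
Qed.

Inductive cmd :=
| Skip
| Push of reg & bool
| Pop of reg
| Seq of cmd & cmd
| If of reg & pred (option bool) & cmd & cmd
| While of reg & pred (option bool) & cmd.

(** The count is the exact number of machine steps: a push takes two (move left, then write), and
    every test takes one. *)
Inductive exec : cmd -> store -> nat -> store -> Prop :=
| exec_skip s : exec Skip s 1 s
| exec_push r b s : exec (Push r b) s 2 (set_reg s r (b :: get s r))
| exec_pop r s : exec (Pop r) s 1 (set_reg s r (behead (get s r)))
| exec_seq c1 c2 s1 s2 s3 t1 t2 :
    exec c1 s1 t1 s2 -> exec c2 s2 t2 s3 -> exec (Seq c1 c2) s1 (t1 + t2) s3
| exec_ift r (p : pred (option bool)) c1 c2 s s' t :
    p (ohead (get s r)) -> exec c1 s t s' -> exec (If r p c1 c2) s t.+1 s'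
| exec_iff r (p : pred (option bool)) c1 c2 s s' t :
    ~~ p (ohead (get s r)) -> exec c2 s t s' -> exec (If r p c1 c2) s t.+1 s'
| exec_whilef r (p : pred (option bool)) c s :
    ~~ p (ohead (get s r)) -> exec (While r p c) s 1 s
| exec_whilet r (p : pred (option bool)) c s1 s2 s3 t1 t2 :
    p (ohead (get s1 r)) -> exec c s1 t1 s2 -> exec (While r p c) s2 t2 s3 ->
    exec (While r p c) s1 (t1 + t2).+1 s3.

(** * Compilation of stack programs into four-tape machines *)

Definition sym := symbol void.
Definition tapes := reg -> tape void.

Definition bit_of (a : sym) : option bool :=
  if a is Some (inl b) then Some b else None.

Fixpoint states (c : cmd) : finType :=
  match c with
  | Skip | Pop _ => unit
  | Push _ _ => bool
  | Seq c1 c2 => (states c1 + states c2)%type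
  | If _ _ c1 c2 => (unit + (states c1 + states c2))%type
  | While _ _ c1 => (unit + states c1)%type
  end.

Fixpoint entry (c : cmd) : states c :=
  match c with
  | Skip | Pop _ => tt
  | Push _ _ => false
  | Seq c1 c2 => inl (entry c1)
  | If _ _ c1 c2 => inl tt
  | While _ _ c1 => inl tt
  end.

Definition action := reg -> sym * move.

Definition act_on (rd : {ffun reg -> sym}) (r : reg) (a : sym) (d : move) :
    action :=
  fun r' => if r' == r then (a, d) else (rd r', Stay).

Definition act_none (rd : {ffun reg -> sym}) : action := fun r => (rd r, Stay).

(** The next state [None] means that control leaves the code of [c]; the enclosing construct
    redirects it to the entry of what follows. *)
Fixpoint delta (c : cmd) :
    states c -> {ffun reg -> sym} -> option (states c) * action :=
  match c return states c -> {ffun reg -> sym} -> option (states c) * action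
  with
  | Skip => fun _ rd => (None, act_none rd)
  | Pop r => fun _ rd => (None, act_on rd r None MoveRight)
  | Push r b => fun x rd =>
      if x then (None, act_on rd r (Some (inl b)) Stay)
      else (Some true, act_on rd r (rd r) MoveLeft)
  | Seq c1 c2 => fun x rd =>
      match x with
      | inl y => let d := delta y rd in
          (Some (if d.1 is Some z then inl z else inr (entry c2)), d.2)
      | inr y => let d := delta y rd in (omap inr d.1, d.2)
      end
  | If r p c1 c2 => fun x rd =>
      match x with
      | inl _ =>
          (Some (inr (if p (bit_of (rd r)) then inl (entry c1)
                      else inr (entry c2))), act_none rd)
      | inr (inl y) => let d := delta y rd in
          (omap (fun z => inr (inl z)) d.1, d.2)
      | inr (inr y) => let d := delta y rd in
          (omap (fun z => inr (inr z)) d.1, d.2)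
      end
  | While r p c1 => fun x rd =>
      match x with
      | inl _ =>
          (if p (bit_of (rd r)) then Some (inr (entry c1)) else None,
           act_none rd)
      | inr y => let d := delta y rd in
          (Some (if d.1 is Some z then inr z else inl tt), d.2)
      end
  end.

Definition reads (tp : tapes) : {ffun reg -> sym} :=
  [ffun i => tape_read (tp i)].

Definition perform (tp : tapes) (a : action) : tapes :=
  fun i => tape_move (tape_write (tp i) (a i).1) (a i).2.

Inductive run (c : cmd) : states c -> tapes -> nat -> tapes -> Prop :=
| run_exit x tp : (delta x (reads tp)).1 = None ->
    run x tp 1 (perform tp (delta x (reads tp)).2)
| run_next x tp y t tp' : (delta x (reads tp)).1 = Some y ->
    run y (perform tp (delta x (reads tp)).2) t tp' -> run x tp t.+1 tp'.

(** The cells left of the head are unconstrained, since a push overwrites the cell it moves onto.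
    The explicit blanks arise when an exhausted tape is written on. *)
Definition holds_stack (tp : tape void) (s : seq bool) :=
  exists k, tape_right tp = [seq Some (inl b) | b <- s] ++ nseq k None.

Definition represents (tp : tapes) (s : store) :=
  forall r, holds_stack (tp r) (get s r).

Lemma bit_of_read tp s r :
  represents tp s -> bit_of (reads tp r) = ohead (get s r).
Proof.
move=> /(_ r) [k]; rewrite ffunE /tape_read => ->.
by case: (get s r) => [|b l] //=; case: k.
Qed.

Lemma holds_stack_rewrite tp s :
  holds_stack tp s -> holds_stack (tape_write tp (tape_read tp)) s.
Proof.
case=> k Hk; rewrite /holds_stack /tape_write /tape_read /= Hk.
case: s {Hk} => [|b s] /=; last by exists k.
by case: k => [|k]; [exists 1 | exists k.+1].
Qed.

Lemma represents_none tp s :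
  represents tp s -> represents (perform tp (act_none (reads tp))) s.
Proof.
by move=> H r; rewrite /perform /= ffunE; exact: holds_stack_rewrite.
Qed.

Lemma run_seqr c1 c2 (x : states c2) tp t tp' :
  run x tp t tp' -> @run (Seq c1 c2) (inr x) tp t tp'.
Proof.
elim=> {x tp t tp'} [x tp e|x tp y t tp' e _ IH].
  by apply: (@run_exit (Seq c1 c2) (inr x)); rewrite /= e.
by apply: (@run_next (Seq c1 c2) (inr x) _ (inr y)); rewrite /= ?e.
Qed.

Lemma run_seq c1 c2 (x : states c1) tp t1 tp1 t2 tp2 :
  run x tp t1 tp1 -> run (entry c2) tp1 t2 tp2 ->
  @run (Seq c1 c2) (inl x) tp (t1 + t2) tp2.
Proof.
move=> H; elim: H => {x tp t1 tp1} [x tp e|x tp y t tp' e _ IH] H2.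
  apply: (@run_next (Seq c1 c2) (inl x) _ (inr (entry c2))).
    by rewrite /= e.
  exact: run_seqr.
apply: (@run_next (Seq c1 c2) (inl x) _ (inl y)); first by rewrite /= e.
exact: IH.
Qed.

Lemma run_ifl r p c1 c2 (x : states c1) tp t tp' :
  run x tp t tp' -> @run (If r p c1 c2) (inr (inl x)) tp t tp'.
Proof.
elim=> {x tp t tp'} [x tp e|x tp y t tp' e _ IH].
  by apply: (@run_exit (If r p c1 c2) (inr (inl x))); rewrite /= e.
by apply: (@run_next (If r p c1 c2) (inr (inl x)) _ (inr (inl y)));
  rewrite /= ?e.
Qed.

Lemma run_ifr r p c1 c2 (x : states c2) tp t tp' :
  run x tp t tp' -> @run (If r p c1 c2) (inr (inr x)) tp t tp'.
Proof.
elim=> {x tp t tp'} [x tp e|x tp y t tp' e _ IH].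
  by apply: (@run_exit (If r p c1 c2) (inr (inr x))); rewrite /= e.
by apply: (@run_next (If r p c1 c2) (inr (inr x)) _ (inr (inr y)));
  rewrite /= ?e.
Qed.

Lemma run_while r p c (x : states c) tp t tp' t2 tp2 :
  run x tp t tp' -> @run (While r p c) (inl tt) tp' t2 tp2 ->
  @run (While r p c) (inr x) tp (t + t2) tp2.
Proof.
move=> H; elim: H => {x tp t tp'} [x tp e|x tp y t tp' e _ IH] H2.
  apply: (@run_next (While r p c) (inr x) _ (inl tt)); last exact: H2.
  by rewrite /= e.
apply: (@run_next (While r p c) (inr x) _ (inr y)); first by rewrite /= e.
exact: IH.
Qed.

(** Step-for-step simulation, by induction on the execution; the lemmas on [run] above embed the run
    of a subprogram into that of the whole. *)
Lemma exec_run c s t s' : exec c s t s' -> forall tp, represents tp s ->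
  exists2 tp', run (entry c) tp t tp' & represents tp' s'.
Proof.
elim=> {c s t s'} [s|r b s|r s|c1 c2 s1 s2 s3 t1 t2 _ IH1 _ IH2
    |r p c1 c2 s s' t Hp _ IH|r p c1 c2 s s' t Hp _ IH|r p c s Hp
    |r p c s1 s2 s3 t1 t2 Hp _ IH1 _ IH2] tp Htp.
- by eexists; [apply: run_exit | exact: represents_none].
- eexists.
    by apply: (@run_next (Push r b) false _ true) => //; apply: run_exit.
  move=> r'; rewrite get_set_reg /= /perform /act_on.
  case: eqP => [->|/eqP ne]; last first.
    rewrite !ffunE (negPf ne) /=; do 2 apply: holds_stack_rewrite.
    exact: Htp.
  have [k Hk] := holds_stack_rewrite (Htp r).
  by exists k; rewrite /= ffunE; move: Hk => /= ->.
- eexists; first by apply: run_exit.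
  move=> r'; rewrite get_set_reg /= /perform /act_on.
  case: eqP => [->|/eqP ne]; last first.
    by rewrite !ffunE /=; apply: holds_stack_rewrite; exact: Htp.
  have [k Hk] := Htp r.
  rewrite /holds_stack /= Hk.
  by case: (get s r) => [|b l] /=; [exists k.-1; case: k {Hk} | exists k].
- have [tp1 H1 R1] := IH1 _ Htp; have [tp2 H2 R2] := IH2 _ R1.
  by exists tp2 => //; exact: run_seq H1 H2.
- have [tp1 H1 R1] := IH _ (represents_none Htp).
  exists tp1 => //.
  apply: (@run_next (If r p c1 c2) (inl tt) _ (inr (inl (entry c1)))).
    by rewrite /= (bit_of_read _ Htp) Hp.
  exact: run_ifl.
- have [tp1 H1 R1] := IH _ (represents_none Htp).
  exists tp1 => //.
  apply: (@run_next (If r p c1 c2) (inl tt) _ (inr (inr (entry c2)))).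
    by rewrite /= (bit_of_read _ Htp) (negPf Hp).
  exact: run_ifr.
- eexists; last exact: represents_none Htp.
  apply: (@run_exit (While r p c) (inl tt)).
  by rewrite /= (bit_of_read _ Htp) (negPf Hp).
- have [tp1 H1 R1] := IH1 _ (represents_none Htp).
  have [tp2 H2 R2] := IH2 _ R1.
  exists tp2 => //.
  apply: (@run_next (While r p c) (inl tt) _ (inr (entry c))).
    by rewrite /= (bit_of_read _ Htp) Hp.
  exact: run_while H1 H2.
Qed.

Definition tm_of (c : cmd) : tm :=
  @TM 3 (option (states c)) void (Some (entry c)) (fun x => x == None)
    (fun x rd => if x is Some y then delta y rd else (None, act_none rd)).

Lemma run_tm c (x : states c) tp t tp' : run x tp t tp' ->
  iter t (@tm_step (tm_of c)) (Some x, tp) = (None, tp').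
Proof.
elim=> {x tp t tp'} [x tp e|x tp y t tp' e _ IH].
  by rewrite /= /tm_step /= -/(reads tp) e.
by rewrite iterSr {2}/tm_step /= -/(reads tp) e -/(perform _ _).
Qed.

Lemma tm_halted M (c : config M) t : tm_halt c.1 -> iter t (@tm_step M) c = c.
Proof. by move=> H; elim: t => //= t ->; rewrite /tm_step H. Qed.

Definition execs c s n s' := exists2 t, t <= n & exec c s t s'.

(** The machine may stop early; halting configurations being fixed points, running it for the full
    bound changes nothing. *)
Lemma exec_polytime (f : seq bool -> seq bool) c (p : {poly nat}) :
  (forall w, execs c (Store w [::] [::] [::]) p.[size w]%R
                     (Store (f w) [::] [::] [::])) -> polytime f.
Proof.
move=> H; exists (tm_of c), p => w /=.
have [t le_t Hex] := H w.
have [|tp' Hrun Htp'] :=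
  exec_run Hex (tp := fun i => Tape [::] (if i == ord0 then
    [seq Some (inl b) | b <- w] else [::])).
  move=> r; exists 0; rewrite /= cats0 -val_eqE.
  by case: r => -[|[|[|[|//]]]] ?.
rewrite -(subnK le_t) iterD /tm_init (run_tm Hrun) tm_halted //.
split=> //; rewrite /tm_output /=.
have [k ->] := Htp' ord0.
by elim: (f w) => [|b l /= ->//]; case: k.
Qed.

Section ExecRules.
Implicit Types (c : cmd) (s : store) (r : reg) (p : pred (option bool)).

Lemma execs_le c s n m s' : execs c s n s' -> n <= m -> execs c s m s'.
Proof. by move=> [t le_t H] le_nm; exists t => //; exact: leq_trans le_nm. Qed.

Lemma execs_skip s : execs Skip s 1 s.
Proof. by exists 1 => //; exact: exec_skip. Qed.

Lemma execs_push r b s : execs (Push r b) s 2 (set_reg s r (b :: get s r)).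
Proof. by exists 2 => //; exact: exec_push. Qed.

Lemma execs_pop r s : execs (Pop r) s 1 (set_reg s r (behead (get s r))).
Proof. by exists 1 => //; exact: exec_pop. Qed.

Lemma execs_seq c1 c2 s1 n1 s2 n2 s3 :
  execs c1 s1 n1 s2 -> execs c2 s2 n2 s3 ->
  execs (Seq c1 c2) s1 (n1 + n2) s3.
Proof.
move=> [t1 l1 H1] [t2 l2 H2]; exists (t1 + t2); first exact: leq_add.
exact: exec_seq H1 H2.
Qed.

Lemma execs_ift r p c1 c2 s n s' :
  p (ohead (get s r)) -> execs c1 s n s' -> execs (If r p c1 c2) s n.+1 s'.
Proof. by move=> Hp [t l H]; exists t.+1 => //; exact: exec_ift. Qed.

Lemma execs_iff r p c1 c2 s n s' :
  ~~ p (ohead (get s r)) -> execs c2 s n s' -> execs (If r p c1 c2) s n.+1 s'.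
Proof. by move=> Hp [t l H]; exists t.+1 => //; exact: exec_iff. Qed.

Lemma execs_whilef r p c s :
  ~~ p (ohead (get s r)) -> execs (While r p c) s 1 s.
Proof. by move=> Hp; exists 1 => //; exact: exec_whilef. Qed.

Lemma execs_whilet r p c s1 n1 s2 n2 s3 :
  p (ohead (get s1 r)) -> execs c s1 n1 s2 -> execs (While r p c) s2 n2 s3 ->
  execs (While r p c) s1 (n1 + n2).+1 s3.
Proof.
move=> Hp [t1 l1 H1] [t2 l2 H2]; exists (t1 + t2).+1.
  by rewrite ltnS leq_add.
exact: exec_whilet H1 H2.
Qed.

End ExecRules.

Definition store_size s :=
  let: Store a b c d := s in size a + size b + size c + size d.

(** The stacks grow by at most one bit per unit of time, so a time bound also bounds the size of the
    result. *)
Lemma exec_size c s t s' : exec c s t s' -> store_size s' <= store_size s + t.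
Proof.
elim=> {c s t s'} [s|r b s|r s|c1 c2 s1 s2 s3 t1 t2 _ IH1 _ IH2
    |r p c1 c2 s s' t Hp _ IH|r p c1 c2 s s' t Hp _ IH|r p c s Hp
    |r p c s1 s2 s3 t1 t2 Hp _ IH1 _ IH2]; try lia.
- by case: s => a b' c d; case: r => -[|[|[|[|//]]]] ? /=; lia.
- by case: s => a b c d; case: r => -[|[|[|[|//]]]] ? /=;
    rewrite size_behead; lia.
Qed.

Lemma execs_size c s n s' :
  execs c s n s' -> store_size s' <= store_size s + n.
Proof. by move=> [t l /exec_size H]; lia. Qed.

(** * Functions computed by stack programs in polynomial time *)

Inductive tree := Nil | Cons of tree & tree.

Fixpoint ser (d : tree) : seq bool :=
  if d is Cons a b then true :: ser a ++ ser b else [:: false].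

Class encodable (A : Type) := enc : A -> tree.
Arguments enc {A encodable} x : simpl never.

#[global] Instance enc_unit : encodable unit := fun _ => Nil.
(** Booleans share their codes with lists of units of length at most one, and numbers, being unary,
    with lists of units. Tests and counters thus reduce to case analysis and iteration on lists;
    large numbers are handled as words of bits instead. *)
#[global] Instance enc_bool : encodable bool :=
  fun b => if b then Cons Nil Nil else Nil.
Fixpoint unary (n : nat) : tree := if n is m.+1 then Cons Nil (unary m) else Nil.
#[global] Instance enc_nat : encodable nat := unary.
#[global] Instance enc_prod A B (eA : encodable A) (eB : encodable B) :
  encodable (A * B) := fun p => Cons (enc p.1) (enc p.2).
Fixpoint list_tree A (e : A -> tree) (l : seq A) : tree :=
  if l is a :: l' then Cons (e a) (list_tree e l') else Nil.
#[global] Instance enc_seq A (eA : encodable A) : encodable (seq A) :=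
  list_tree eA.

Definition sz A (eA : encodable A) (x : A) := size (ser (enc x)).
Arguments sz {A eA} x.

Section EncodingSize.
Context {A B : Type} {eA : encodable A} {eB : encodable B}.

Lemma ser_pair (x : A) (y : B) :
  ser (enc (x, y)) = true :: ser (enc x) ++ ser (enc y).
Proof. by []. Qed.

Lemma ser_cons (x : A) (l : seq A) :
  ser (enc (x :: l)) = true :: ser (enc x) ++ ser (enc l).
Proof. by []. Qed.

Lemma sz_pair (x : A) (y : B) : sz (x, y) = (sz x + sz y).+1.
Proof. by rewrite /sz ser_pair /= size_cat. Qed.

Lemma sz_nil : sz ([::] : seq A) = 1.
Proof. by []. Qed.

Lemma sz_cons (x : A) (l : seq A) : sz (x :: l) = (sz x + sz l).+1.
Proof. by rewrite /sz ser_cons /= size_cat. Qed.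
End EncodingSize.

(** * Moving prefix-coded trees between stacks *)

Definition top_true (o : option bool) := o == Some true.

Definition main (s : seq bool) := Store s [::] [::] [::].

Lemma catrevs0 T (s : seq T) : catrev s [::] = rev s.
Proof. by []. Qed.

(* Empties [r], running [body b] on each bit [b] popped from it.               *)
Definition drain (r : reg) (body : bool -> cmd) : cmd :=
  While r isSome (If r top_true (Seq (Pop r) (body true))
                                (Seq (Pop r) (body false))).

(** [st d l] is the loop invariant: [l] is what remains on [r], and [d] holds the bits already
    handled, latest first. *)
Lemma execs_drain r body n (st : seq bool -> seq bool -> store) l d :
  (forall d' l', get (st d' l') r = l') ->
  (forall b d' l', execs (body b) (set_reg (st d' (b :: l')) r l') n
                                  (st (b :: d') l')) ->
  execs (drain r body) (st d l) ((n + 3) * size l + 1) (st (catrev l d) [::]).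
Proof.
move=> Hget Hbody; elim: l d => [|b l IH] d.
  by rewrite muln0; apply: execs_whilef; rewrite Hget.
apply: execs_le (_ : (1 + n).+1 + ((n + 3) * size l + 1) < _); last first.
  by rewrite /= mulnS; lia.
apply: execs_whilet (IH _); first by rewrite Hget.
have step : execs (Seq (Pop r) (body b)) (st d (b :: l)) (1 + n)
                  (st (b :: d) l).
  apply: execs_seq (execs_pop _ _) _; rewrite Hget; exact: Hbody.
by case: b step => step; [apply: execs_ift step | apply: execs_iff step];
  rewrite Hget.
Qed.

(* [pick r] moves one tree in prefix code from [RS] to [r], reversing it; the *)
(* stack [RC] counts in unary the subtrees still to be read.                  *)
Definition pick_body (r : reg) : cmd :=
  If RS top_true (Seq (Pop RS) (Seq (Push r true) (Push RC true)))
                 (Seq (Pop RS) (Seq (Push r false) (Pop RC))).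

Definition pick (r : reg) : cmd :=
  Seq (Push RC true) (While RC isSome (pick_body r)).

Section Pick.
Variables (r : reg) (st : seq bool -> seq bool -> seq bool -> store).
Hypothesis getS : forall s d c, get (st s d c) RS = s.
Hypothesis getr : forall s d c, get (st s d c) r = d.
Hypothesis getC : forall s d c, get (st s d c) RC = c.
Hypothesis setS : forall s d c x, set_reg (st s d c) RS x = st x d c.
Hypothesis setr : forall s d c x, set_reg (st s d c) r x = st s x c.
Hypothesis setC : forall s d c x, set_reg (st s d c) RC x = st s d x.

Lemma execs_pick_body b s d c :
  execs (pick_body r) (st (b :: s) d (true :: c)) 6
        (st s (b :: d) (if b then [:: true, true & c] else c)).
Proof.
case: b.
  apply: execs_ift; first by rewrite getS.
  apply: (execs_seq (n1 := 1) (n2 := 4)); first exact: execs_pop.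
  apply: (execs_seq (n1 := 2) (n2 := 2)); first exact: execs_push.
  rewrite getS setS getr setr.
  by have := execs_push RC true (st s (true :: d) (true :: c));
     rewrite getC setC.
apply: execs_le (_ : 5 <= 6) => //.
apply: execs_iff; first by rewrite getS.
apply: (execs_seq (n1 := 1) (n2 := 3)); first exact: execs_pop.
apply: (execs_seq (n1 := 2) (n2 := 1)); first exact: execs_push.
rewrite getS setS getr setr.
by have := execs_pop RC (st s (false :: d) (true :: c)); rewrite getC setC.
Qed.

(** Reading one tree uses up one unit of the counter. Having the rest of the loop as a premise lets
    the induction chain the two subtrees of a node. *)
Lemma execs_pick_loop v s d c n s' :
  execs (While RC isSome (pick_body r)) (st s (rev (ser v) ++ d) c) n s' ->
  execs (While RC isSome (pick_body r)) (st (ser v ++ s) d (true :: c))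
        (7 * size (ser v) + n) s'.
Proof.
elim: v s d c n s' => [|a IHa b IHb] s d c n s' H /=.
  apply: execs_le (_ : (6 + n).+1 <= _); last by lia.
  by apply: execs_whilet (execs_pick_body _ _ _ _) H; rewrite getC.
apply: execs_le (_ : (6 + (7 * size (ser a) + (7 * size (ser b) + n))).+1 <= _);
  last by rewrite size_cat; lia.
apply: execs_whilet (execs_pick_body _ _ _ _) _; first by rewrite getC.
rewrite -catA; apply: IHa; apply: IHb.
by move: H; rewrite /= rev_cons rev_cat cat_rcons -catA.
Qed.

Lemma execs_pick v s :
  execs (pick r) (st (ser v ++ s) [::] [::]) (7 * size (ser v) + 3)
        (st s (rev (ser v)) [::]).
Proof.
apply: execs_le (_ : 2 + (7 * size (ser v) + 1) <= _); last by lia.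
apply: execs_seq (execs_push _ _ _) _; rewrite getC setC.
by apply: execs_pick_loop; rewrite cats0; apply: execs_whilef; rewrite getC.
Qed.
End Pick.

Lemma execs_pickA v s b :
  execs (pick RA) (Store (ser v ++ s) [::] b [::]) (7 * size (ser v) + 3)
        (Store s (rev (ser v)) b [::]).
Proof. exact: (@execs_pick RA (fun s d c => Store s d b c)). Qed.

Lemma execs_pickB v s a :
  execs (pick RB) (Store (ser v ++ s) a [::] [::]) (7 * size (ser v) + 3)
        (Store s a (rev (ser v)) [::]).
Proof. exact: (@execs_pick RB (fun s d c => Store s a d c)). Qed.

Lemma execs_pourA l s b c :
  execs (drain RA (Push RS)) (Store s l b c) (5 * size l + 1)
        (Store (catrev l s) [::] b c).
Proof.
have := @execs_drain RA (Push RS) 2 (fun d l => Store (d ++ s) l b c) l [::].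
rewrite catrevs0 -catrevE; apply=> // x d' l'; exact: execs_push.
Qed.

Lemma execs_pourB l s a c :
  execs (drain RB (Push RS)) (Store s a l c) (5 * size l + 1)
        (Store (catrev l s) a [::] c).
Proof.
have := @execs_drain RB (Push RS) 2 (fun d l => Store (d ++ s) a l c) l [::].
rewrite catrevs0 -catrevE; apply=> // x d' l'; exact: execs_push.
Qed.

Definition cmd_swap : cmd :=
  Seq (pick RA) (Seq (pick RB)
    (Seq (drain RA (Push RS)) (drain RB (Push RS)))).

Lemma execs_swap u v s :
  execs cmd_swap (main (ser u ++ ser v ++ s))
    (12 * (size (ser u) + size (ser v)) + 8) (main (ser v ++ ser u ++ s)).
Proof.
set m := size (ser u); set n := size (ser v).
apply: (@execs_le _ _ ((7 * m + 3) + ((7 * n + 3) +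
  ((5 * m + 1) + (5 * n + 1))))); last by lia.
apply: execs_seq (execs_pickA _ _ _) _.
apply: execs_seq (execs_pickB _ _ _) _.
have := execs_pourA (rev (ser u)) s (rev (ser v)) [::].
rewrite catrevE revK size_rev => H; apply: execs_seq H _.
have := execs_pourB (rev (ser v)) (ser u ++ s) [::] [::].
by rewrite catrevE revK size_rev.
Qed.

Definition cmd_drop : cmd := Seq (pick RA) (drain RA (fun _ => Skip)).

Lemma execs_drop u s :
  execs cmd_drop (main (ser u ++ s)) (11 * size (ser u) + 4) (main s).
Proof.
apply: (@execs_le _ _ ((7 * size (ser u) + 3) + (4 * size (ser u) + 1)));
  last by lia.
apply: execs_seq (execs_pickA _ _ _) _.
have := @execs_drain RA (fun _ => Skip) 1 (fun d l => Store s l [::] [::])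
  (rev (ser u)) [::].
by rewrite size_rev; apply=> // *; exact: execs_skip.
Qed.

Definition cmd_dup : cmd :=
  Seq (pick RA) (Seq (drain RA (fun b => Seq (Push RS b) (Push RB b)))
    (Seq (drain RB (Push RA)) (drain RA (Push RS)))).

Lemma execs_dup u s :
  execs cmd_dup (main (ser u ++ s)) (24 * size (ser u) + 6)
        (main (ser u ++ ser u ++ s)).
Proof.
set n := size (ser u).
apply: (@execs_le _ _ ((7 * n + 3) + ((7 * n + 1) +
  ((5 * n + 1) + (5 * n + 1))))); last by lia.
apply: execs_seq (execs_pickA _ _ _) _.
have := @execs_drain RA (fun b => Seq (Push RS b) (Push RB b)) 4
  (fun d l => Store (d ++ s) l d [::]) (rev (ser u)) [::].
rewrite size_rev -/n catrevs0 revK => H.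
apply: execs_seq (H _ _) _ => // [b d l|].
  by apply: (execs_seq (n1 := 2) (n2 := 2)); exact: execs_push.
have := @execs_drain RB (Push RA) 2 (fun d l => Store (ser u ++ s) d l [::])
  (ser u) [::].
rewrite -/n catrevs0 => {}H.
apply: execs_seq (H _ _) _ => // [b d l|]; first exact: execs_push.
have := execs_pourA (rev (ser u)) (ser u ++ s) [::] [::].
by rewrite catrevE revK size_rev.
Qed.

(** * Polynomial-time functions on encoded data *)

Definition pbd A (eA : encodable A) (f : A -> nat) :=
  exists k, forall x, f x <= (sz x + 2) ^ k.
Arguments pbd {A eA} f.

(** The arbitrary remainder [s] is left untouched below the argument, so other values can wait there
    during a computation. *)
Definition polyf A B (eA : encodable A) (eB : encodable B) (f : A -> B) :=
  exists c, exists2 T, pbd T & forall x s,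
    execs c (main (ser (enc x) ++ s)) (T x) (main (ser (enc (f x)) ++ s)).
Arguments polyf {A B eA eB} f.

Lemma leq_expl m n e : m <= n -> m ^ e <= n ^ e.
Proof. by case: e => // e; rewrite leq_exp2r. Qed.

Section Bounds.
Context {A : Type} {eA : encodable A}.
Implicit Types f g : A -> nat.

Lemma pbd_le f g : (forall x, f x <= g x) -> pbd g -> pbd f.
Proof. by move=> H [k Hk]; exists k => x; exact: leq_trans (Hk x). Qed.

Lemma pbd_const n : pbd (fun _ : A => n).
Proof.
exists n => x; apply: leq_trans (ltnW (ltn_expl n (ltnSn 1))) _.
by apply: leq_expl; rewrite leq_addl.
Qed.

(** The base [sz x + 2] is at least 2, so one extra exponent absorbs the factor 2 in u + v <=
    2uv. *)
Lemma pbd_add f g : pbd f -> pbd g -> pbd (fun x => f x + g x).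
Proof.
move=> [a Ha] [b Hb]; exists (a + b + 1) => x.
apply: leq_trans (leq_add (Ha x) (Hb x)) _.
rewrite !expnD expn1 [X in _ <= X]mulnC.
have : 0 < (sz x + 2) ^ a by rewrite expn_gt0 addn2.
have : 0 < (sz x + 2) ^ b by rewrite expn_gt0 addn2.
move: (_ ^ a) (_ ^ b) => u v ? ?.
apply: (@leq_trans (2 * (u * v))); first by nia.
by apply: leq_mul; rewrite ?leq_addl.
Qed.

Lemma pbd_mul f g : pbd f -> pbd g -> pbd (fun x => f x * g x).
Proof. by move=> [a Ha] [b Hb]; exists (a + b) => x; rewrite expnD leq_mul. Qed.

Lemma pbd_exp f k : pbd f -> pbd (fun x => f x ^ k).
Proof.
move=> Hf; elim: k => [|k IH]; first exact: pbd_const.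
by apply: (@pbd_le _ (fun x => f x * f x ^ k)) (pbd_mul Hf IH) => x; rewrite expnS.
Qed.

Lemma pbd_id : pbd (fun x : A => sz x).
Proof. by exists 1 => x; rewrite expn1 leq_addr. Qed.
End Bounds.

Lemma pbd_comp A B (eA : encodable A) (eB : encodable B) (f : A -> B)
    (g : B -> nat) :
  pbd (fun x => sz (f x)) -> pbd g -> pbd (fun x => g (f x)).
Proof.
move=> Hf [b Hb].
apply: (@pbd_le _ _ _ (fun x => (sz (f x) + 2) ^ b)) => [x|]; first exact: Hb.
by apply: pbd_exp; apply: pbd_add => //; exact: pbd_const.
Qed.

Section Basics.
Context {A B : Type} {eA : encodable A} {eB : encodable B}.

Lemma polyf_sz (f : A -> B) : polyf f -> pbd (fun x => sz (f x)).
Proof.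
move=> [c [T HT H]]; apply: (@pbd_le _ _ _ (fun x => sz x + T x)).
  move=> x; have /execs_size := H x [::].
  by rewrite /= !cats0 !addn0.
by apply: pbd_add => //; exact: pbd_id.
Qed.

Lemma polyf_ext (f g : A -> B) : f =1 g -> polyf f -> polyf g.
Proof.
by move=> e [c [T HT H]]; exists c, T => // x s; rewrite -e.
Qed.

Lemma polyf_retype (f : A -> B) :
  (forall x, enc (f x) = enc x) -> polyf f.
Proof.
move=> e; exists Skip, (fun=> 1); first exact: pbd_const.
by move=> x s; rewrite e; exact: execs_skip.
Qed.

End Basics.

Section Prims.
Context {A B C : Type} {eA : encodable A} {eB : encodable B} {eC : encodable C}.

Lemma polyf_comp (f : A -> B) (g : B -> C) :
  polyf f -> polyf g -> polyf (fun x => g (f x)).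
Proof.
move=> Hf; have szf := polyf_sz Hf; case: Hf => [cf [Tf HTf Hf]].
move=> [cg [Tg HTg Hg]]; exists (Seq cf cg), (fun x => Tf x + Tg (f x)).
  by apply: pbd_add => //; exact: pbd_comp.
by move=> x s; apply: execs_seq (Hf _ _) (Hg _ _).
Qed.

(** Duplicate x, apply g to the upper copy, swap, apply f to the other copy; the two codes then lie
    in the right order and one [true] makes them a pair. *)
Lemma polyf_pair (f : A -> B) (g : A -> C) :
  polyf f -> polyf g -> polyf (fun x => (f x, g x)).
Proof.
move=> [cf [Tf HTf Hf]] Hg; have szg := polyf_sz Hg.
case: Hg => [cg [Tg HTg Hg]].
exists (Seq cmd_dup (Seq cg (Seq cmd_swap (Seq cf (Push RS true))))).
exists (fun x => (24 * sz x + 6) + (Tg x + ((12 * (sz (g x) + sz x) + 8) +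
  (Tf x + 2)))).
  by do ![apply: pbd_add => // | apply: pbd_mul => // | exact: pbd_const
         | exact: pbd_id].
move=> x s.
apply: execs_seq (execs_dup _ _) _; apply: execs_seq (Hg _ _) _.
apply: execs_seq (execs_swap _ _ _) _; apply: execs_seq (Hf _ _) _.
by rewrite /enc /enc_prod /= -catA; exact: execs_push.
Qed.

Definition push_word (w : seq bool) : cmd :=
  foldr (fun b c => Seq c (Push RS b)) Skip w.

Lemma execs_push_word w s :
  execs (push_word w) (main s) (2 * size w + 1) (main (w ++ s)).
Proof.
elim: w => [|b w IH] /=; first exact: execs_skip.
apply: execs_le (_ : (2 * size w + 1) + 2 <= _); last by lia.
by apply: execs_seq IH _; exact: execs_push.
Qed.

Lemma polyf_const (b : B) : polyf (fun _ : A => b).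
Proof.
exists (Seq cmd_drop (push_word (ser (enc b)))).
exists (fun x => (11 * sz x + 4) + (2 * sz b + 1)).
  by do ![apply: pbd_add => // | apply: pbd_mul => // | exact: pbd_const
         | exact: pbd_id].
move=> x s; apply: execs_seq (execs_drop _ _) _; exact: execs_push_word.
Qed.

Lemma polyf_fst : polyf (fun p : A * B => p.1).
Proof.
exists (Seq (Pop RS) (Seq cmd_swap cmd_drop)).
exists (fun p => 1 + ((12 * sz p + 8) + (11 * sz p + 4))).
  by do ![apply: pbd_add => // | apply: pbd_mul => // | exact: pbd_const
         | exact: pbd_id].
move=> [x y] s; rewrite /sz /enc /enc_prod /= -catA.
apply: execs_seq (execs_pop _ _) _ => /=.
apply: execs_seq.
  by apply: execs_le (execs_swap _ _ _) _; rewrite /enc /= size_cat; lia.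
by apply: execs_le (execs_drop _ _) _; rewrite /enc size_cat; lia.
Qed.

Lemma polyf_snd : polyf (fun p : A * B => p.2).
Proof.
exists (Seq (Pop RS) cmd_drop).
exists (fun p => 1 + (11 * sz p + 4)).
  by do ![apply: pbd_add => // | apply: pbd_mul => // | exact: pbd_const
         | exact: pbd_id].
move=> [x y] s; rewrite /sz /enc /enc_prod /= -catA.
apply: execs_seq (execs_pop _ _) _ => /=.
by apply: execs_le (execs_drop _ _) _; rewrite /enc size_cat; lia.
Qed.

(* The encoding of [(a :: l, x)] is literally that of [((a, l), x)].          *)
Lemma polyf_case_pair (f : A -> C) (g : (B * seq B) * A -> C) :
  polyf f -> polyf g ->
  polyf (fun p : seq B * A =>
           if p.1 is b :: l then g ((b, l), p.2) else f p.2).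
Proof.
move=> [cf [Tf [kf HTf] Hf]] [cg [Tg [kg HTg] Hg]].
exists (Seq (Pop RS) (If RS top_true (Seq (Push RS true) cg)
                                     (Seq (Pop RS) cf))).
exists (fun p => (((sz p + 2) ^ kf + (sz p + 2) ^ kg) + 4)).
  by do ![apply: pbd_add => // | apply: pbd_exp => // | exact: pbd_const
         | exact: pbd_id].
move=> [[|b l] x] s /=.
  apply: (@execs_le _ _ (1 + (1 + (sz x + 2) ^ kf).+1)).
    apply: execs_seq (execs_pop _ _) _; apply: execs_iff => //.
    apply: execs_seq (execs_pop _ _) _ => /=.
    by apply: execs_le (HTf x); exact: Hf.
  have : (sz x + 2) ^ kf <= (sz ([::] : seq B, x) + 2) ^ kf.
    by apply: leq_expl; rewrite sz_pair; lia.
  by lia.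
apply: (@execs_le _ _ (1 + (2 + (sz ((b, l), x) + 2) ^ kg).+1)).
  apply: execs_seq (execs_pop _ _) _; apply: execs_ift => //.
  apply: execs_seq (execs_push _ _ _) _.
  by apply: execs_le (HTg _); exact: Hg.
have -> : sz (b :: l, x) = sz (b, l, x) by [].
by lia.
Qed.

End Prims.

Section Iteration.
Context {A B C : Type} {eA : encodable A} {eB : encodable B} {eC : encodable C}.

(** The list serves as fuel, one element being dropped per round. The bound on all iterates is a
    hypothesis because repeating a polynomial-time step may produce values of exponential size. *)
Lemma polyf_iter (n : A -> seq C) (i : A -> B) (f : B -> B) :
  polyf n -> polyf i -> polyf f ->
  (exists2 bd, pbd bd &
    forall x k, k <= size (n x) -> sz (iter k f (i x)) <= bd x) ->
  polyf (fun x => iter (size (n x)) f (i x)).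
Proof.
move=> Hn Hi [cf [Tf [kf HTf] Hf]] [bd Hbd Hbound].
have Hsz := polyf_sz Hn.
have [cp [Tp HTp Hp]] := polyf_pair Hn Hi.
pose body := Seq (Pop RS) (Seq cmd_drop (Seq cmd_swap (Seq cf cmd_swap))).
pose cost m b := 1 + ((11 * m + 4) + ((12 * (m + b) + 8) + ((b + 2) ^ kf +
                   (12 * (m + b) + 8)))).
have loop (l : seq C) b s x z :
    sz l <= x -> (forall k, k <= size l -> sz (iter k f b) <= z) ->
    execs (While RS top_true body) (main (ser (enc l) ++ ser (enc b) ++ s))
      (size l * (cost x z).+1 + 1)
      (main (false :: ser (enc (iter (size l) f b)) ++ s)).
  elim: l b => [|a l IH] b Hl Hz.
    by rewrite mul0n; exact: execs_whilef.
  move: Hl; rewrite sz_cons => Hl.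
  have H : execs (While RS top_true body)
      (main (ser (enc l) ++ ser (enc (f b)) ++ s)) (size l * (cost x z).+1 + 1)
      (main (false :: ser (enc (iter (size l) f (f b))) ++ s)).
    apply: IH => [|k le_k]; first by lia.
    by have := Hz k.+1 le_k; rewrite iterSr.
  rewrite [size (a :: l)]/= iterSr.
  apply: (@execs_le _ _ (cost x z + (size l * (cost x z).+1 + 1)).+1);
    last by lia.
  apply: execs_whilet H => //.
  have sb := Hz 0 isT; have sfb := Hz 1 isT.
  rewrite /cost; apply: execs_seq (execs_pop _ _) _.
  rewrite ser_cons cat_cons -catA [set_reg _ _ _]/=.
  apply: execs_seq.
    by apply: execs_le (execs_drop _ _) _; rewrite -/(sz a); lia.
  apply: execs_seq.
    apply: execs_le (execs_swap _ _ _) _.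
    by rewrite -/(sz b) -/(sz l); move: sb => /=; lia.
  apply: execs_seq.
    apply: execs_le (Hf _ _) _; apply: leq_trans (HTf _) _.
    by apply: leq_expl => //; rewrite leq_add2r.
  apply: execs_le (execs_swap _ _ _) _.
  by rewrite -/(sz (f b)) -/(sz l); move: sfb => /=; lia.
have le_n (l : seq C) : size l <= sz l.
  by elim: l => // a l IH; rewrite sz_cons /=; lia.
exists (Seq cp (Seq (Pop RS) (Seq (While RS top_true body) (Pop RS)))).
exists (fun x => Tp x + (1 + ((sz (n x) * (cost (sz (n x)) (bd x)).+1 + 1) + 1))).
  have Hc : pbd (fun x => (cost (sz (n x)) (bd x)).+1).
    apply: (@pbd_le _ _ _ (fun x => 1 + cost (sz (n x)) (bd x))) => //.
    by do ![apply: pbd_add => // | apply: pbd_mul => // | apply: pbd_exp => //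
         | exact: pbd_const | exact: pbd_id].
  by do ![apply: pbd_add => // | apply: pbd_mul => // | exact: pbd_const].
move=> x s; apply: execs_seq (Hp _ _) _.
rewrite ser_pair cat_cons -catA; apply: execs_seq (execs_pop _ _) _.
rewrite [set_reg _ _ _]/=.
have H := loop (n x) (i x) s _ _ (leqnn _) (Hbound x).
apply: execs_seq; last exact: (execs_pop RS (main (false :: _))).
by apply: execs_le H _; rewrite leq_add2r leq_mul2r le_n orbT.
Qed.
End Iteration.

(** * Conversion between plain words and coded words *)

Definition raw_to_tree : cmd :=
  Seq (drain RS (Push RA)) (Seq (Push RS false)
    (drain RA (fun b => push_word (true :: ser (enc b))))).

Lemma sz_word (w : seq bool) : sz w <= 4 * size w + 1.
Proof.
elim: w => //= b w; rewrite /sz /= size_cat.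
by move=> H; case: b => /=; rewrite /enc /= in H *; lia.
Qed.

Lemma execs_raw_to_tree w :
  execs raw_to_tree (main w) (20 * size w + 4) (main (ser (enc w))).
Proof.
apply: (@execs_le _ _ ((5 * size w + 1) + (2 + ((9 + 3) * size w + 1))));
  last by lia.
have := @execs_drain RS (Push RA) 2 (fun d l => Store l d [::] [::]) w [::].
rewrite catrevs0 => H; apply: execs_seq (H _ _) _ => //.
  by move=> *; exact: execs_push.
apply: execs_seq (execs_push _ _ _) _ => /=.
have := @execs_drain RA (fun b => push_word (true :: ser (enc b))) 9
  (fun d l => Store (ser (enc d)) l [::] [::]) (rev w) [::].
rewrite size_rev catrevs0 revK; apply=> // b d l /=.
have push_wordE v : forall s, execs (push_word v) (Store s l [::] [::])
    (2 * size v + 1) (Store (v ++ s) l [::] [::]).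
  elim: v => [|x v IH] s /=; first exact: execs_skip.
  apply: execs_le (_ : (2 * size v + 1) + 2 <= _); last by lia.
  by apply: execs_seq (IH _) _; exact: execs_push.
apply: execs_le (push_wordE (true :: ser (enc b)) _) _.
by case: b.
Qed.

Definition tree_to_raw : cmd :=
  Seq (While RS top_true (Seq (Pop RS)
        (If RS top_true
           (Seq (Pop RS) (Seq (Pop RS) (Seq (Pop RS) (Push RA true))))
           (Seq (Pop RS) (Push RA false)))))
   (Seq (Pop RS) (drain RA (Push RS))).

Lemma execs_tree_to_raw w :
  execs tree_to_raw (main (ser (enc w))) (20 * size w + 3) (main w).
Proof.
apply: (@execs_le _ _ ((8 * size w + 1) + (1 + (5 * size w + 1))));
  last by lia.
have loop d : execs (While RS top_true (Seq (Pop RS)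
        (If RS top_true
           (Seq (Pop RS) (Seq (Pop RS) (Seq (Pop RS) (Push RA true))))
           (Seq (Pop RS) (Push RA false)))))
    (Store (ser (enc w)) d [::] [::]) (8 * size w + 1)
    (Store [:: false] (catrev w d) [::] [::]).
  elim: w d => [|b w IH] d /=.
    by rewrite muln0; exact: execs_whilef.
  apply: execs_le (_ : 7 + (8 * size w + 1) < _); last by lia.
  apply: execs_whilet (IH _) => //.
  apply: (execs_seq (n1 := 1) (n2 := 6)); first exact: execs_pop.
  case: b => /=.
    apply: execs_ift => //.
    apply: (execs_seq (n1 := 1) (n2 := 4)); first exact: execs_pop.
    apply: (execs_seq (n1 := 1) (n2 := 3)); first exact: execs_pop.
    apply: (execs_seq (n1 := 1) (n2 := 2)); first exact: execs_pop.
    exact: execs_push.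
  apply: (@execs_le _ _ 4) => //; apply: execs_iff => //.
  apply: (execs_seq (n1 := 1) (n2 := 2)); first exact: execs_pop.
  exact: execs_push.
apply: execs_seq (loop [::]) _; rewrite catrevs0.
apply: execs_seq (execs_pop _ _) _ => /=.
by have := execs_pourA (rev w) [::] [::] [::]; rewrite catrevE revK size_rev cats0.
Qed.

Lemma polyf_polytime (f : seq bool -> seq bool) : polyf f -> polytime f.
Proof.
move=> Hf; have [kz Hz] := polyf_sz Hf; case: Hf => [c [T [k HT] H]].
(* 4|w| + 3 bounds [sz w + 2] by [sz_word]. The power k bounds the run of [c], the power kz the size
   of its output, which is still to be converted back; the linear terms cover the conversion of the
   input. *)
pose p : {poly nat} := (((4%:R *: 'X + 3%:P) ^+ k + 24%:R *: 'X + 10%:P) +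
  20%:R *: (4%:R *: 'X + 3%:P) ^+ kz)%R.
apply: (@exec_polytime f (Seq raw_to_tree (Seq c tree_to_raw)) p) => w.
have hw := sz_word w.
have le_sz (v : seq bool) : size v <= sz v.
  by elim: v => //= b v; rewrite /sz /= size_cat /enc /=; case: b => /=; lia.
apply: execs_le (_ : (20 * size w + 4) + ((4 * size w + 3) ^ k +
  (20 * (4 * size w + 3) ^ kz + 3)) <= _); last first.
  suff -> : p.[size w]%R = (4 * size w + 3) ^ k + 24 * size w + 10 +
                           20 * (4 * size w + 3) ^ kz by lia.
  by rewrite /p !(hornerD, hornerZ, horner_exp, hornerX, hornerC) !natrXE.
apply: execs_seq (execs_raw_to_tree _) _.
apply: execs_seq.
  rewrite -[ser _]cats0; apply: execs_le (H _ _) _.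
  apply: leq_trans (HT _) _; apply: leq_expl => //; lia.
rewrite cats0; apply: execs_le (execs_tree_to_raw _) _.
rewrite leq_add2r leq_mul2l /=; apply: leq_trans (le_sz _) _.
by apply: leq_trans (Hz _) _; apply: leq_expl => //; lia.
Qed.

(** * Closure properties *)

Section ListSize.
Context {A B : Type} {eA : encodable A} {eB : encodable B}.
Implicit Types s t : seq A.

Lemma sz_gt0 (x : A) : 0 < sz x.
Proof. by rewrite /sz; case: (enc x). Qed.

Lemma sz_cat s t : (sz (s ++ t)).+1 = sz s + sz t.
Proof.
elim: s => [|a s IH]; first by rewrite sz_nil add1n.
by rewrite cat_cons !sz_cons -addSn -addnS; lia.
Qed.

Lemma sz_rev s : sz (rev s) = sz s.
Proof.
elim: s => // a s IH; rewrite rev_cons -cats1 sz_cons.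
pose proof (sz_cat (rev s) [:: a]) as H; rewrite IH sz_cons sz_nil in H; lia.
Qed.

Lemma size_le_sz s : size s <= sz s.
Proof. by elim: s => // a s IH; rewrite sz_cons /=; lia. Qed.

Lemma sz_map_le (f : A -> B) s n m :
  sz s <= n -> (forall a, sz a <= n -> sz (f a) <= m) ->
  sz [seq f a | a <- s] <= size s * m.+1 + 1.
Proof.
move=> Hs Hf; elim: s Hs => [|a s IH]; first by rewrite sz_nil.
rewrite sz_cons => Hs; rewrite /= sz_cons.
have := Hf a; have := IH; lia.
Qed.
End ListSize.

Lemma sz_nat (n : nat) : sz n = 2 * n + 1.
Proof. by rewrite /sz /enc /=; elim: n => //= n ->; lia. Qed.

Lemma sz_bool (b : bool) : sz b <= 3.
Proof. by case: b. Qed.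

Ltac pbd_tac := repeat first
  [ assumption | apply: pbd_const | apply: pbd_id | apply: polyf_sz; assumption
  | apply: pbd_add | apply: pbd_mul | apply: pbd_exp ].

Section Projections.
Context {X A B C : Type} {eX : encodable X} {eA : encodable A}
  {eB : encodable B} {eC : encodable C}.

Lemma pt_id : polyf (fun x : X => x).
Proof. exact: polyf_retype. Qed.

Lemma pt_fst (f : X -> A * B) : polyf f -> polyf (fun x => (f x).1).
Proof. by move=> Hf; apply: polyf_comp Hf _; exact: polyf_fst. Qed.

Lemma pt_snd (f : X -> A * B) : polyf f -> polyf (fun x => (f x).2).
Proof. by move=> Hf; apply: polyf_comp Hf _; exact: polyf_snd. Qed.

Lemma pt_cons (f : X -> A) (g : X -> seq A) :
  polyf f -> polyf g -> polyf (fun x => f x :: g x).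
Proof.
move=> Hf Hg.
apply: (@polyf_comp _ (A * seq A)%type _ _ _ _ _ (fun p => p.1 :: p.2)
          (polyf_pair Hf Hg)).
by apply: polyf_retype => -[].
Qed.

Lemma pt_case (l : X -> seq A) (f : X -> C) (g : X -> A -> seq A -> C) :
  polyf l -> polyf f ->
  polyf (fun p : (A * seq A) * X => g p.2 p.1.1 p.1.2) ->
  polyf (fun x => if l x is a :: l' then g x a l' else f x).
Proof.
move=> Hl Hf Hg.
exact: (polyf_comp (polyf_pair Hl pt_id) (polyf_case_pair Hf Hg)).
Qed.
End Projections.

Section Folding.
Context {X A B C : Type} {eX : encodable X} {eA : encodable A}
  {eB : encodable B} {eC : encodable C}.

Lemma pt_if (b : X -> bool) (f g : X -> C) :
  polyf b -> polyf f -> polyf g -> polyf (fun x => if b x then f x else g x).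
Proof.
move=> Hb Hf Hg.
pose l x := if b x then [:: tt] else [::].
have Hl : polyf l.
  apply: (polyf_comp Hb (g := fun c : bool => if c then [:: tt] else [::])).
  by apply: polyf_retype => -[].
apply: polyf_ext (pt_case Hl Hg (g := fun x _ _ => f x) _) => [x|].
  by rewrite /l; case: (b x).
apply: (@polyf_comp _ X _ _ _ _ (fun p => p.2)) Hf; exact: polyf_snd.
Qed.

Lemma polyf_nseq : polyf (fun n => nseq n tt).
Proof. by apply: polyf_retype; elim=> //= n; rewrite /enc /= => <-. Qed.

Lemma pt_succn (n : X -> nat) : polyf n -> polyf (fun x => (n x).+1).
Proof.
move=> Hn.
apply: (@polyf_comp _ (unit * nat)%type _ _ _ _ (fun x => (tt, n x))
          (fun p => p.2.+1)).
  by apply: polyf_pair => //; exact: polyf_const.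
by apply: polyf_retype => -[[] k].
Qed.

Lemma pt_predn (n : X -> nat) : polyf n -> polyf (fun x => (n x).-1).
Proof.
move=> Hn.
have H1 : polyf (fun x => nseq (n x) tt) by apply: polyf_comp Hn polyf_nseq.
have H2 : polyf (fun x => behead (nseq (n x) tt)).
  apply: polyf_ext (pt_case H1 (polyf_const [::])
    (g := fun _ _ l' => l') _) => [x|]; first by case: (nseq _ _).
  by apply: pt_snd; exact: polyf_fst.
have H3 : polyf (@size unit).
  apply: polyf_retype; elim=> [//|[] l]; rewrite /enc /= => IH.
  by rewrite /enc /= IH.
by apply: polyf_ext (polyf_comp H2 H3) => x /=; rewrite size_behead size_nseq.
Qed.

Lemma pt_eq0 (n : X -> nat) : polyf n -> polyf (fun x => n x == 0).
Proof.
move=> Hn.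
have H1 : polyf (fun x => nseq (n x) tt) by apply: polyf_comp Hn polyf_nseq.
apply: polyf_ext (pt_case H1 (polyf_const true)
   (g := fun _ _ _ => false) (polyf_const _)) => x.
by case: (n x).
Qed.

Lemma pt_iter (n : X -> nat) (i : X -> A) (f : X -> A -> A) :
  polyf n -> polyf i -> polyf (fun p : X * A => f p.1 p.2) ->
  (exists2 bd, pbd bd &
    forall x k, k <= n x -> sz (iter k (f x) (i x)) <= bd x) ->
  polyf (fun x => iter (n x) (f x) (i x)).
Proof.
move=> Hn Hi Hf [bd Hbd Hb].
have H1 : polyf (fun x => nseq (n x) tt) by apply: polyf_comp Hn polyf_nseq.
have Hf' : polyf (fun p : X * A => (p.1, f p.1 p.2)).
  by apply: polyf_pair Hf; exact: polyf_fst.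
have iterE x k : iter k (fun p : X * A => (p.1, f p.1 p.2)) (x, i x) =
    (x, iter k (f x) (i x)) by elim: k => //= k ->.
have := polyf_iter H1 (polyf_pair pt_id Hi) Hf'.
case=> [|c [T HT H]].
  exists (fun x => sz x + bd x + 1); first by pbd_tac.
  move=> x k; rewrite size_nseq iterE sz_pair => /Hb; lia.
apply: polyf_ext (pt_snd (B := A) (ex_intro _ c (ex_intro2 _ _ T HT H))) => x /=.
by rewrite size_nseq iterE.
Qed.

(** Each round of an iteration moves one element from the pending list into the accumulator. The
    values on prefixes of the list are the intermediate results, hence the form of the size
    bound. *)
Lemma pt_foldl (l : X -> seq B) (i : X -> A) (f : X -> A -> B -> A) :
  polyf l -> polyf i -> polyf (fun p : X * A * B => f p.1.1 p.1.2 p.2) ->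
  (exists2 bd, pbd bd & forall x s1 s2, l x = s1 ++ s2 ->
    sz (foldl (f x) (i x) s1) <= bd x) ->
  polyf (fun x => foldl (f x) (i x) (l x)).
Proof.
move=> Hl Hi Hf [bd Hbd Hb].
pose st := (X * A * seq B)%type.
pose step (p : st) : st :=
  if p.2 is b :: s then (p.1.1, f p.1.1 p.1.2 b, s) else p.
have Hstep : polyf step.
  apply: (pt_case (l := fun p : st => p.2)
    (g := fun p b s => (p.1.1, f p.1.1 p.1.2 b, s))).
  - exact: polyf_snd.
  - exact: pt_id.
  apply: polyf_pair; last by apply: pt_snd; exact: polyf_fst.
  apply: polyf_pair; first by do 2 apply: pt_fst; exact: polyf_snd.
  apply: (polyf_comp (f := fun p : (B * seq B) * st => (p.2.1, p.1.1)) _ Hf).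
  by apply: polyf_pair; apply: pt_fst; [exact: polyf_snd | exact: polyf_fst].
have iterE x s1 s2 a :
    iter (size s1) step (x, a, s1 ++ s2) = (x, foldl (f x) a s1, s2).
  by elim: s1 a => //= b s1 IH a; rewrite -iterS iterSr IH.
have := polyf_iter Hl (polyf_pair (polyf_pair pt_id Hi) Hl) Hstep.
case=> [|c [T HT H]].
  exists (fun x => sz x + bd x + sz (l x) + 2); first by pbd_tac.
  move=> x k le_k; have e := cat_take_drop k (l x).
  have := iterE x (take k (l x)) (drop k (l x)) (i x).
  rewrite e size_takel // => ->; rewrite !sz_pair.
  have := Hb x _ _ (esym e); pose proof (sz_cat (take k (l x)) (drop k (l x))) as H1.
  rewrite e in H1; pose proof (sz_gt0 (take k (l x))); lia.
apply: polyf_ext (pt_snd (pt_fst (ex_intro _ c (ex_intro2 _ _ T HT H)))) => x /=.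
by have := iterE x (l x) [::] (i x); rewrite cats0 => ->.
Qed.

End Folding.

Section Reversal.
Context {X A B C : Type} {eX : encodable X} {eA : encodable A}
  {eB : encodable B} {eC : encodable C}.

Lemma pt_rev (l : X -> seq A) : polyf l -> polyf (fun x => rev (l x)).
Proof.
move=> Hl.
have foldlE (s t : seq A) : foldl (fun acc b => b :: acc) t s = catrev s t.
  by elim: s t => //= b s IH t.
apply: polyf_ext (pt_foldl Hl (polyf_const ([::] : seq A))
    (f := fun _ acc b => b :: acc) _ _) => [x||].
- by rewrite foldlE.
- by apply: pt_cons; [exact: polyf_snd | apply: pt_snd; exact: polyf_fst].
exists (fun x => sz (l x)); first by pbd_tac.
move=> x s1 s2 ->; rewrite foldlE catrevs0 sz_rev.
by pose proof (sz_cat s1 s2); pose proof (sz_gt0 s2); lia.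
Qed.
End Reversal.

Section RightFolding.
Context {X A B C : Type} {eX : encodable X} {eA : encodable A}
  {eB : encodable B} {eC : encodable C}.

Lemma pt_foldr (l : X -> seq B) (i : X -> A) (f : X -> B -> A -> A) :
  polyf l -> polyf i -> polyf (fun p : X * A * B => f p.1.1 p.2 p.1.2) ->
  (exists2 bd, pbd bd & forall x s1 s2, l x = s1 ++ s2 ->
    sz (foldr (f x) (i x) s2) <= bd x) ->
  polyf (fun x => foldr (f x) (i x) (l x)).
Proof.
move=> Hl Hi Hf [bd Hbd Hb].
apply: polyf_ext (pt_foldl (pt_rev Hl) Hi (f := fun x a b => f x b a) Hf _).
  by move=> x; rewrite foldl_rev.
exists bd => // x s1 s2 e.
have := Hb x (rev s2) (rev s1); rewrite -rev_cat -e revK => /(_ erefl).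
by rewrite -[s1 in X in _ -> X]revK foldl_rev.
Qed.

End RightFolding.

Section Lists.
Context {X A B C : Type} {eX : encodable X} {eA : encodable A}
  {eB : encodable B} {eC : encodable C}.

Lemma pt_map (l : X -> seq B) (f : X -> B -> C) :
  polyf l -> polyf (fun p : X * B => f p.1 p.2) ->
  polyf (fun x => [seq f x b | b <- l x]).
Proof.
move=> Hl Hf.
apply: polyf_ext (pt_foldr Hl (polyf_const ([::] : seq C))
    (f := fun x b acc => f x b :: acc) _ _) => [//||].
  apply: pt_cons; last by apply: pt_snd; exact: polyf_fst.
  apply: (polyf_comp (f := fun p : X * seq C * B => (p.1.1, p.2)) _ Hf).
  by apply: polyf_pair; [apply: pt_fst; exact: polyf_fst | exact: polyf_snd].
have [k Hk] := polyf_sz Hf.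
exists (fun x => sz (l x) * ((sz x + sz (l x) + 3) ^ k + 1) + 1).
  by pbd_tac.
move=> x s1 s2 e.
have le2 : sz s2 <= sz (l x).
  by rewrite e; pose proof (sz_cat s1 s2); pose proof (sz_gt0 s1); lia.
rewrite -/(map (f x) s2).
apply: leq_trans (@sz_map_le _ _ _ _ (f x) s2 _ ((sz x + sz (l x) + 3) ^ k)
                    le2 _) _.
  move=> a le_a; apply: leq_trans (Hk (x, a)) _; apply: leq_expl.
  by rewrite sz_pair; lia.
by rewrite leq_add2r addn1 leq_mul //; exact: leq_trans (size_le_sz _) le2.
Qed.

Lemma pt_filter (l : X -> seq B) (p : X -> B -> bool) :
  polyf l -> polyf (fun y : X * B => p y.1 y.2) ->
  polyf (fun x => [seq b <- l x | p x b]).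
Proof.
move=> Hl Hp.
apply: polyf_ext (pt_foldr Hl (polyf_const ([::] : seq B))
    (f := fun x b acc => if p x b then b :: acc else acc) _ _) => [//||].
  apply: pt_if.
  - apply: (polyf_comp (f := fun y : X * seq B * B => (y.1.1, y.2)) _ Hp).
    by apply: polyf_pair; [apply: pt_fst; exact: polyf_fst | exact: polyf_snd].
  - by apply: pt_cons; [exact: polyf_snd | apply: pt_snd; exact: polyf_fst].
  - by apply: pt_snd; exact: polyf_fst.
exists (fun x => sz (l x)); first by pbd_tac.
move=> x s1 s2 e.
have le2 : sz s2 <= sz (l x).
  by rewrite e; pose proof (sz_cat s1 s2); pose proof (sz_gt0 s1); lia.
apply: leq_trans le2 => {e}; elim: s2 => //= b s IH.
by case: ifP => _; rewrite !sz_cons; lia.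
Qed.

Lemma pt_cat (f g : X -> seq A) :
  polyf f -> polyf g -> polyf (fun x => f x ++ g x).
Proof.
move=> Hf Hg.
have foldrE (s t : seq A) : foldr cons t s = s ++ t by elim: s => //= a s ->.
apply: polyf_ext (pt_foldr Hf Hg (f := fun _ b acc => b :: acc) _ _) => [x||].
- by rewrite foldrE.
- by apply: pt_cons; [exact: polyf_snd | apply: pt_snd; exact: polyf_fst].
exists (fun x => sz (f x) + sz (g x)); first by pbd_tac.
move=> x s1 s2 ->; rewrite foldrE.
pose proof (sz_cat s1 s2); pose proof (sz_cat s2 (g x)); pose proof (sz_gt0 s1); lia.
Qed.

Lemma pt_size (l : X -> seq A) : polyf l -> polyf (fun x => size (l x)).
Proof.
move=> Hl.
apply: polyf_ext (pt_foldr Hl (polyf_const 0) (f := fun _ _ n => n.+1) _ _)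
  => [x||].
- by elim: (l x) => //= a s ->.
- by apply: pt_succn; apply: pt_snd; exact: polyf_fst.
exists (fun x => 2 * sz (l x) + 1); first by pbd_tac.
move=> x s1 s2 ->.
have -> : foldr (fun (_ : A) n => n.+1) 0 s2 = size s2.
  by elim: s2 => //= a s ->.
rewrite sz_nat; pose proof (size_le_sz s2); pose proof (sz_cat s1 s2).
by pose proof (sz_gt0 s1); lia.
Qed.

Lemma pt_has (l : X -> seq B) (p : X -> B -> bool) :
  polyf l -> polyf (fun y : X * B => p y.1 y.2) ->
  polyf (fun x => has (p x) (l x)).
Proof.
move=> Hl Hp.
apply: polyf_ext (pt_foldr Hl (polyf_const false)
    (f := fun x b acc => if p x b then true else acc) _ _) => [x||].
- by elim: (l x) => //= b s <-; case: (p x b).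
- apply: pt_if; last by apply: pt_snd; exact: polyf_fst.
    apply: (polyf_comp (f := fun y : X * bool * B => (y.1.1, y.2)) _ Hp).
    by apply: polyf_pair; [apply: pt_fst; exact: polyf_fst | exact: polyf_snd].
  exact: polyf_const.
by exists (fun x => 3); [pbd_tac | move=> *; exact: sz_bool].
Qed.

Lemma pt_behead (l : X -> seq A) : polyf l -> polyf (fun x => behead (l x)).
Proof.
move=> Hl; apply: polyf_ext (pt_case Hl (polyf_const [::])
  (g := fun _ _ l' => l') _) => [x|]; first by case: (l x).
by apply: pt_snd; exact: polyf_fst.
Qed.

Lemma pt_head (d : A) (l : X -> seq A) :
  polyf l -> polyf (fun x => head d (l x)).
Proof.
move=> Hl; apply: polyf_ext (pt_case Hl (polyf_const d)
  (g := fun _ a _ => a) _) => [x|]; first by case: (l x).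
by apply: pt_fst; exact: polyf_fst.
Qed.

Lemma pt_nilp (l : X -> seq A) : polyf l -> polyf (fun x => nilp (l x)).
Proof.
move=> Hl; apply: polyf_ext (pt_case Hl (polyf_const true)
  (g := fun _ _ _ => false) (polyf_const _)) => x; by case: (l x).
Qed.

Lemma pt_negb (b : X -> bool) : polyf b -> polyf (fun x => ~~ b x).
Proof.
by move=> Hb; apply: polyf_ext (pt_if Hb (polyf_const false) (polyf_const true)).
Qed.

Lemma pt_andb (b c : X -> bool) :
  polyf b -> polyf c -> polyf (fun x => b x && c x).
Proof. by move=> Hb Hc; apply: polyf_ext (pt_if Hb Hc (polyf_const false)). Qed.

Lemma pt_orb (b c : X -> bool) :
  polyf b -> polyf c -> polyf (fun x => b x || c x).
Proof. by move=> Hb Hc; apply: polyf_ext (pt_if Hb (polyf_const true) Hc). Qed.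

Lemma pt_eqb (b c : X -> bool) :
  polyf b -> polyf c -> polyf (fun x => b x == c x).
Proof.
move=> Hb Hc; apply: polyf_ext (pt_if Hb Hc (pt_negb Hc)) => x.
by case: (b x); case: (c x).
Qed.

Lemma pt_addn (m n : X -> nat) :
  polyf m -> polyf n -> polyf (fun x => m x + n x).
Proof.
move=> Hm Hn.
have iterE k j : iter k succn j = k + j by rewrite iter_succn addnC.
apply: polyf_ext (pt_iter Hm Hn (f := fun _ k => k.+1) _ _) => [x||].
- exact: iterE.
- by apply: pt_succn; exact: polyf_snd.
exists (fun x => sz (m x) + sz (n x)); first by pbd_tac.
by move=> x k le_k; rewrite iterE !sz_nat; lia.
Qed.

Lemma pt_subn (m n : X -> nat) :
  polyf m -> polyf n -> polyf (fun x => m x - n x).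
Proof.
move=> Hm Hn.
have iterE k j : iter k predn j = j - k by rewrite iter_predn.
apply: polyf_ext (pt_iter Hn Hm (f := fun _ k => k.-1) _ _) => [x||].
- exact: iterE.
- by apply: pt_predn; exact: polyf_snd.
exists (fun x => sz (m x)); first by pbd_tac.
by move=> x k le_k; rewrite iterE !sz_nat; lia.
Qed.
End Lists.

Section Arithmetic.
Context {X A B C : Type} {eX : encodable X} {eA : encodable A}
  {eB : encodable B} {eC : encodable C}.

Lemma pt_muln (m n : X -> nat) :
  polyf m -> polyf n -> polyf (fun x => m x * n x).
Proof.
move=> Hm Hn.
have iterE k j : iter k (addn j) 0 = k * j by rewrite iter_addn_0 mulnC.
apply: polyf_ext (pt_iter Hm (polyf_const 0) (f := fun x k => n x + k) _ _)
  => [x||].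
- exact: iterE.
- apply: pt_addn; last exact: polyf_snd.
  by apply: polyf_comp Hn; exact: polyf_fst.
exists (fun x => 2 * (sz (m x) * sz (n x)) + 1); first by pbd_tac.
move=> x k le_k; rewrite iterE !sz_nat leq_add2r leq_mul2l /=.
by apply: leq_mul; lia.
Qed.

Lemma pt_leq (m n : X -> nat) :
  polyf m -> polyf n -> polyf (fun x => m x <= n x).
Proof. by move=> Hm Hn; exact: pt_eq0 (pt_subn Hm Hn). Qed.

Lemma pt_eqn (m n : X -> nat) :
  polyf m -> polyf n -> polyf (fun x => m x == n x).
Proof.
move=> Hm Hn; apply: polyf_ext (pt_andb (pt_leq Hm Hn) (pt_leq Hn Hm)) => x.
by rewrite eqn_leq.
Qed.

Lemma pt_flatten (l : X -> seq (seq A)) :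
  polyf l -> polyf (fun x => flatten (l x)).
Proof.
move=> Hl.
apply: (pt_foldr Hl (polyf_const [::]) (f := fun _ => cat)).
  by apply: pt_cat; [exact: polyf_snd | apply: pt_snd; exact: polyf_fst].
exists (fun x => sz (l x)); first by pbd_tac.
move=> x s1 s2 ->; pose proof (sz_cat s1 s2) as le2; pose proof (sz_gt0 s1).
have Hs : sz (flatten s2) <= sz s2.
  elim: s2 {le2} => // a s IH; rewrite sz_cons /=.
  by pose proof (sz_cat a (flatten s)); lia.
by change (sz (flatten s2) <= sz (s1 ++ s2)); lia.
Qed.

Lemma pt_all (l : X -> seq B) (p : X -> B -> bool) :
  polyf l -> polyf (fun y : X * B => p y.1 y.2) ->
  polyf (fun x => all (p x) (l x)).
Proof.
move=> Hl Hp; apply: polyf_ext (pt_negb (pt_has Hl (pt_negb Hp))) => x.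
rewrite -all_predC; apply: eq_all => b /=; exact: negbK.
Qed.

Lemma pt_count (l : X -> seq B) (p : X -> B -> bool) :
  polyf l -> polyf (fun y : X * B => p y.1 y.2) ->
  polyf (fun x => count (p x) (l x)).
Proof.
move=> Hl Hp; apply: polyf_ext (pt_size (pt_filter Hl Hp)) => x.
exact: size_filter.
Qed.

Lemma pt_nth (d : A) (l : X -> seq A) (n : X -> nat) :
  polyf l -> polyf n -> polyf (fun x => nth d (l x) (n x)).
Proof.
move=> Hl Hn.
have iterE k (s : seq A) : iter k behead s = drop k s.
  by elim: k s => [|k IH] s; [rewrite drop0 | rewrite iterSr IH; case: s].
have H : polyf (fun x => drop (n x) (l x)).
  apply: polyf_ext (pt_iter Hn Hl (f := fun _ => behead) _ _) => [x||].
  - exact: iterE.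
  - by apply: pt_behead; exact: polyf_snd.
  exists (fun x => sz (l x)); first by pbd_tac.
  move=> x k _; rewrite iterE.
  pose proof (sz_cat (take k (l x)) (drop k (l x))) as H; rewrite cat_take_drop in H.
  by pose proof (sz_gt0 (take k (l x))); lia.
by apply: polyf_ext (pt_head d H) => x; rewrite -nth0 nth_drop addn0.
Qed.

Lemma pt_iota0 (n : X -> nat) : polyf n -> polyf (fun x => iota 0 (n x)).
Proof.
move=> Hn.
have iterE j k : k <= j -> iter k (fun p : nat * seq nat => (p.1.-1, p.1.-1 :: p.2))
    (j, [::]) = (j - k, iota (j - k) k).
  elim: k => [|k IH] le_k; first by rewrite subn0.
  rewrite iterS IH ?(ltnW le_k) //= subnS.
  by congr (_, _ :: iota _ _); lia.
have := pt_iter (n := n) (i := fun x => (n x, [::]))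
   (f := fun _ p => (p.1.-1, p.1.-1 :: p.2)) Hn.
case=> [|||c [T HT H]].
- by apply: polyf_pair => //; exact: polyf_const.
- apply: polyf_pair; first by apply: pt_predn; apply: pt_fst; exact: polyf_snd.
  apply: pt_cons; last by apply: pt_snd; exact: polyf_snd.
  by apply: pt_predn; apply: pt_fst; exact: polyf_snd.
- exists (fun x => sz (n x) + (sz (n x) * (2 * sz (n x) + 2) + 1) + 1).
    by pbd_tac.
  move=> x k le_k; rewrite iterE // sz_pair.
  have -> : iota (n x - k) k = [seq i + (n x - k) | i <- iota 0 k].
    by rewrite -[in LHS](addn0 (n x - k)) iotaDl; apply: eq_map => i; lia.
  have : forall m, m + k <= n x -> sz (iota m k) <= sz (n x) * (2 * sz (n x) + 2) + 1.
    move=> m Hm.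
    have : sz (iota m k) <= k * (2 * n x + 2) + 1.
      elim: k m Hm {le_k} => [|k IH] m Hm //.
      rewrite [iota _ _]/= sz_cons sz_nat.
      by have := IH m.+1; rewrite mulSn; lia.
    move/leq_trans; apply; rewrite leq_add2r; apply: leq_mul; rewrite sz_nat; lia.
  move=> /(_ (n x - k)).
  have -> : [seq i + (n x - k) | i <- iota 0 k] = iota (n x - k) k.
    by rewrite -[in RHS](addn0 (n x - k)) iotaDl; apply: eq_map => i; lia.
  by rewrite !sz_nat; lia.
apply: polyf_ext (pt_snd (A := nat) (ex_intro _ c (ex_intro2 _ _ T HT H))) => x /=.
by rewrite iterE // subnn.
Qed.

Lemma pt_zip (f : X -> seq A) (g : X -> seq B) :
  polyf f -> polyf g -> polyf (fun x => zip (f x) (g x)).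
Proof.
move=> Hf Hg.
pose step (st : seq B * seq (A * B)) (a : A) :=
  if st.1 is b :: t then (t, (a, b) :: st.2) else st.
have stepE s t acc : (foldl step (t, acc) s).2 = catrev (zip s t) acc.
  elim: s t acc => [|a s IH] [|b t] acc //=; last exact: IH.
  by rewrite IH; case: s {IH}.
have stepE1 s t acc : (foldl step (t, acc) s).1 = drop (size s) t.
  elim: s t acc => [|a s IH] [|b t] acc //=; last exact: IH.
  by rewrite IH; case: (size s).
have Hstep : polyf (fun p : X * (seq B * seq (A * B)) * A => step p.1.2 p.2).
  rewrite /step.
  apply: (pt_case (l := fun p : X * (seq B * seq (A * B)) * A => p.1.2.1)
    (g := fun p b t => (t, (p.2, b) :: p.1.2.2))).
  - by apply: pt_fst; apply: pt_snd; exact: polyf_fst.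
  - by apply: pt_snd; exact: polyf_fst.
  apply: polyf_pair; first by apply: pt_snd; exact: polyf_fst.
  apply: pt_cons; last by do 2 apply: pt_snd; apply: pt_fst; exact: polyf_snd.
  by apply: polyf_pair; [apply: pt_snd; exact: polyf_snd
                        | apply: pt_fst; exact: polyf_fst].
have := pt_foldl (l := f) (i := fun x => (g x, [::])) (f := fun _ => step)
  Hf _ Hstep.
case=> [||c [T HT H]].
- by apply: polyf_pair => //; exact: polyf_const.
- exists (fun x => sz (f x) + 2 * sz (g x) + 1); first by pbd_tac.
  move=> x s1 s2 e.
  have le1 : sz s1 <= sz (f x).
    by rewrite e; pose proof (sz_cat s1 s2); pose proof (sz_gt0 s2); lia.
  rewrite [foldl _ _ _]surjective_pairing stepE stepE1 catrevs0 sz_pair sz_rev.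
  have : sz (drop (size s1) (g x)) <= sz (g x).
    pose proof (sz_cat (take (size s1) (g x)) (drop (size s1) (g x))) as H.
    by rewrite cat_take_drop in H; pose proof (sz_gt0 (take (size s1) (g x))); lia.
  have : sz (zip s1 (g x)) <= sz s1 + sz (g x); last by lia.
  elim: s1 (g x) {e le1} => [|a s IH] [|b t] /=; rewrite ?sz_nil //; try by lia.
  by rewrite !sz_cons sz_pair; have := IH t; lia.
apply: polyf_ext (pt_rev (pt_snd (A := seq B)
   (ex_intro _ c (ex_intro2 _ _ T HT H)))) => x /=.
by rewrite stepE catrevs0 revK.
Qed.

End Arithmetic.

Section WordEquality.
Context {X A B C : Type} {eX : encodable X} {eA : encodable A}
  {eB : encodable B} {eC : encodable C}.

Lemma pt_eqword (f g : X -> seq bool) :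
  polyf f -> polyf g -> polyf (fun x => f x == g x).
Proof.
move=> Hf Hg.
have eqE (s t : seq bool) :
    (s == t) = (size s == size t) && all (fun p => p.1 == p.2) (zip s t).
  elim: s t => [|a s IH] [|b t] //=.
  by rewrite eqseq_cons IH eqSS andbCA.
apply: polyf_ext (pt_andb (pt_eqn (pt_size Hf) (pt_size Hg))
  (pt_all (pt_zip Hf Hg) (p := fun _ p => p.1 == p.2) _)) => [x|].
  by rewrite eqE.
by apply: pt_eqb; [apply: pt_fst | apply: pt_snd]; exact: polyf_snd.
Qed.
End WordEquality.

(** [pt] follows the syntax of the function, with one closure lemma per head symbol; [pt_extra] is
    redefined whenever new operations become available. *)
Ltac pt_extra := fail.
Ltac pt_step :=
  cbv beta;
  first [match goal with H : polyf _ |- _ => exact: H end | pt_extra |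
  match goal with
  | |- polyf (fun _ => ?c) => apply: polyf_const
  | |- polyf (fun x => x) => apply: pt_id
  | |- polyf id => apply: pt_id
  | |- polyf (fun x => (@?f x, @?g x)) => apply: (polyf_pair (f := f) (g := g))
  | |- polyf (fun x => fst (@?f x)) => apply: (pt_fst (f := f))
  | |- polyf (fun x => snd (@?f x)) => apply: (pt_snd (f := f))
  | |- polyf (fun x => (@?f x) :: (@?g x)) => apply: (pt_cons (f := f) (g := g))
  | |- polyf (fun x => if _ then _ else _) => apply: pt_if
  | |- polyf (fun x => S (@?f x)) => apply: (pt_succn (n := f))
  | |- polyf (fun x => predn (@?f x)) => apply: (pt_predn (n := f))
  | |- polyf (fun x => addn (@?f x) (@?g x)) => apply: (pt_addn (m := f) (n := g))
  | |- polyf (fun x => subn (@?f x) (@?g x)) => apply: (pt_subn (m := f) (n := g))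
  | |- polyf (fun x => muln (@?f x) (@?g x)) => apply: (pt_muln (m := f) (n := g))
  | |- polyf (fun x => leq (@?f x) (@?g x)) => apply: (pt_leq (m := f) (n := g))
  | |- polyf (fun x => negb (@?f x)) => apply: (pt_negb (b := f))
  | |- polyf (fun x => andb (@?f x) (@?g x)) => apply: (pt_andb (b := f) (c := g))
  | |- polyf (fun x => orb (@?f x) (@?g x)) => apply: (pt_orb (b := f) (c := g))
  | |- polyf (fun x => eq_op (@?f x) (@?g x)) =>
      first [ apply: (pt_eqn (m := f) (n := g)) | apply: (pt_eqb (b := f) (c := g))
            | apply: (pt_eqword (f := f) (g := g)) ]
  | |- polyf (fun x => map (@?f x) (@?l x)) => apply: (pt_map (l := l) (f := f))
  | |- polyf (fun x => filter (@?f x) (@?l x)) =>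
      apply: (pt_filter (l := l) (p := f))
  | |- polyf (fun x => has (@?f x) (@?l x)) => apply: (pt_has (l := l) (p := f))
  | |- polyf (fun x => all (@?f x) (@?l x)) => apply: (pt_all (l := l) (p := f))
  | |- polyf (fun x => count (@?f x) (@?l x)) =>
      apply: (pt_count (l := l) (p := f))
  | |- polyf (fun x => size (@?l x)) => apply: (pt_size (l := l))
  | |- polyf (fun x => rev (@?l x)) => apply: (pt_rev (l := l))
  | |- polyf (fun x => flatten (@?l x)) => apply: (pt_flatten (l := l))
  | |- polyf (fun x => behead (@?l x)) => apply: (pt_behead (l := l))
  | |- polyf (fun x => head ?d (@?l x)) => apply: (pt_head d (l := l))
  | |- polyf (fun x => nilp (@?l x)) => apply: (pt_nilp (l := l))
  | |- polyf (fun x => nth ?d (@?l x) (@?n x)) => apply: (pt_nth d (l := l) (n := n))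
  | |- polyf (fun x => iota 0 (@?n x)) => apply: (pt_iota0 (n := n))
  | |- polyf (fun x => cat (@?f x) (@?g x)) => apply: (pt_cat (f := f) (g := g))
  | |- polyf (fun x => zip (@?f x) (@?g x)) => apply: (pt_zip (f := f) (g := g))
  | |- polyf ?f =>
      lazymatch f with
      | (fun _ => _) => fail
      | _ => change (polyf (fun x => f x))
      end
  end].
Ltac pt := repeat pt_step.

(** * Binary arithmetic *)

Section BinaryWords.
Implicit Types (w s t : seq bool).

Definition word_val w : nat := foldr (fun (b : bool) v => b + v.*2) 0 w.

Lemma word_val_cons (b : bool) w : word_val (b :: w) = b + (word_val w).*2.
Proof. by []. Qed.

Lemma bits_pos m : 0 < m -> bits m = odd m :: bits m./2.
Proof.
move=> m_gt0; rewrite /bits up_log2S // -[(up_log 2 m./2.+1).+1]add1n.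
rewrite /mkseq iotaD map_cat /= expn0 divn1; congr (_ :: _).
rewrite (iotaDl 1 0) -map_comp; apply: eq_map => i /=.
by rewrite add1n expnS divnMA divn2.
Qed.

Lemma word_val_bits m : word_val (bits m) = m.
Proof.
elim/ltn_ind: m => -[//|m] IH; rewrite bits_pos // word_val_cons IH; last by lia.
by rewrite odd_double_half.
Qed.

Lemma bits_inj : injective bits.
Proof. exact: can_inj word_val_bits. Qed.

(** The default makes the empty word, which codes 0, canonical; otherwise the most significant bit
    must be 1. *)
Definition canonical w : bool := last true w.

Lemma canonical_bits m : canonical (bits m).
Proof.
rewrite /canonical; elim/ltn_ind: m => -[//|m] IH; rewrite bits_pos //=.
case: m IH => [//|m] IH.
have := IH m.+2./2; rewrite (@bits_pos m.+2./2) //=.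
by apply; lia.
Qed.

Lemma bits_word_val w : canonical w -> bits (word_val w) = w.
Proof.
rewrite /canonical; elim: w => //= b w IH Hb.
have [e|ne] := eqVneq w [::]; first by move: Hb; rewrite e /= => ->.
have {}Hb : last true w by case: w ne Hb {IH}.
have v_gt0 : 0 < word_val w.
  by have := IH Hb; case: (word_val w) => // e; rewrite -e in ne.
rewrite -/(word_val w) bits_pos; last by lia.
have -> : (b + (word_val w).*2)./2 = word_val w by case: b; lia.
by rewrite IH // oddD odd_double addbF oddb.
Qed.

(** The fold carries each tail along with its successor, because the tail itself is needed as soon
    as the carry stops. *)
Definition bsucc w : seq bool :=
  (foldr (fun b p => (b :: p.1, if b then false :: p.2 else true :: p.1))
         ([::], [:: true]) w).2.

Lemma bsucc_cons b w :
  bsucc (b :: w) = if b then false :: bsucc w else true :: w.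
Proof.
rewrite /bsucc /=; set f := foldr _ _.
by have -> : (f w).1 = w by rewrite /f; elim: (w) => //= ? ? ->.
Qed.

Lemma word_val_bsucc w : word_val (bsucc w) = (word_val w).+1.
Proof.
elim: w => // b w IH; rewrite bsucc_cons.
by case: b; rewrite !word_val_cons ?IH; lia.
Qed.

Lemma canonical_bsucc w : canonical w -> canonical (bsucc w).
Proof.
rewrite /canonical; elim: w => // b w IH; rewrite bsucc_cons.
case: b => /=; last by case: w {IH}.
move=> Hw; have {}Hw := IH Hw.
by case: (bsucc w) (word_val_bsucc w) Hw.
Qed.

Lemma size_bsucc w : size (bsucc w) <= (size w).+1.
Proof. by elim: w => // b w IH; rewrite bsucc_cons; case: b => //=. Qed.

Lemma bitsS m : bits m.+1 = bsucc (bits m).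
Proof.
rewrite -[in LHS](word_val_bits m) -word_val_bsucc bits_word_val //.
exact/canonical_bsucc/canonical_bits.
Qed.

Lemma size_bits m : size (bits m) <= m.
Proof.
elim: m => // m IH; rewrite bitsS; apply: leq_trans (size_bsucc _) _.
by rewrite ltnS.
Qed.

Definition bmaj (a b c : bool) : bool := if a then b || c else b && c.

(** The state consists of the carry, the unread part of the second summand, and the output, latest
    bit first. *)
Definition badd_step (st : bool * seq bool * seq bool) (b : bool) :=
  let x := head false st.1.2 in
  (bmaj b x st.1.1, behead st.1.2, ((b != x) != st.1.1) :: st.2).

Definition badd_end (st : bool * seq bool * seq bool) : seq bool :=
  rev st.2 ++ (if st.1.1 then bsucc st.1.2 else st.1.2).

Definition badd s t := badd_end (foldl badd_step (false, t, [::]) s).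

Lemma word_val_cat s t : word_val (s ++ t) = word_val s + 2 ^ size s * word_val t.
Proof.
elim: s => [|b s IH]; first by rewrite mul1n.
by rewrite cat_cons !word_val_cons IH /= expnS; lia.
Qed.

Lemma word_val_badd_end s (c : bool) t out :
  word_val (badd_end (foldl badd_step (c, t, out) s)) =
  word_val (rev out) + 2 ^ size out * (c + word_val s + word_val t).
Proof.
elim: s c t out => [|b s IH] c t out /=.
  rewrite /badd_end word_val_cat size_rev /= addn0.
  by case: c; rewrite ?word_val_bsucc ?add0n ?add1n.
rewrite IH /= rev_cons -cats1 word_val_cat /= size_rev expnS.
rewrite -/(word_val s).
have -> : word_val t = head false t + (word_val (behead t)).*2.
  by case: (t).
move: (head false t) (word_val (behead t)) (word_val s) => x u v.
by case: b; case: x; case: c => /=; lia.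
Qed.

Lemma word_val_badd s t : word_val (badd s t) = word_val s + word_val t.
Proof. by rewrite /badd word_val_badd_end /= mul1n !add0n. Qed.

Lemma foldl_badd_stepE s c t out :
  let st := foldl badd_step (c, t, out) s in
  st.1.2 = drop (size s) t /\ size st.2 = size s + size out.
Proof.
elim: s c t out => [|b s IH] c t out /=; first by rewrite drop0.
by have [-> ->] := IH (bmaj b (head false t) c) (behead t)
  (((b != head false t) != c) :: out); case: t => //=; split=> //; lia.
Qed.

Lemma size_badd s t : size (badd s t) <= (maxn (size s) (size t)).+1.
Proof.
rewrite /badd /badd_end.
have [e1 e2] := foldl_badd_stepE s false t [::].
rewrite size_cat size_rev e2 e1 /= addn0.
have := size_bsucc (drop (size s) t); rewrite size_drop.
by case: ifP => _; rewrite ?size_drop; lia.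
Qed.

Definition bmul s t : seq bool :=
  foldr (fun b acc => badd (if b then t else [::]) (false :: acc)) [::] s.

Lemma word_val_bmul s t : word_val (bmul s t) = word_val s * word_val t.
Proof.
elim: s => //= b s IH; rewrite word_val_badd word_val_cons IH.
by case: b; rewrite -/(word_val s) /=; lia.
Qed.

Lemma size_bmul s t : size (bmul s t) <= size t + 2 * size s.
Proof.
elim: s => //= b s IH; apply: leq_trans (size_badd _ _) _ => /=.
rewrite -/(bmul s t).
by case: b => /=; lia.
Qed.

(** Bits come least significant first, so the last disagreement decides; the flag is the bit of the
    second word there. *)
Definition blt_step (st : bool * seq bool) (b : bool) :=
  let x := head false st.2 in
  (if b == x then st.1 else x, behead st.2).

Definition blt s t : bool :=
  let st := foldl blt_step (false, t) s in has id st.2 || st.1.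

Lemma bltE s t : blt s t = (word_val s < word_val t).
Proof.
(* Generalise over the flag: a set flag acts as 1 added to the right-hand value, making a tie count
   as less. *)
rewrite -[word_val t]addn0 /blt -[0]/(nat_of_bool false).
elim: s t false => [|b s IH] t c /=.
  elim: t => [|x t IHt] /=; first by case: c.
  by case: x; rewrite //= IHt -/(word_val t) /=; lia.
rewrite {}IH -/(word_val s) /=.
have -> : word_val t = head false t + (word_val (behead t)).*2.
  by case: (t).
move: (head false t) (word_val (behead t)) (word_val s) => x u v.
by case: b; case: x; case: c => /=; lia.
Qed.

End BinaryWords.

Section PolySuccessor.
Context {X : Type} {eX : encodable X}.

Lemma pt_bsucc (f : X -> seq bool) : polyf f -> polyf (fun x => bsucc (f x)).
Proof.
move=> Hf; rewrite /bsucc; apply: pt_snd.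
apply: (pt_foldr (f := fun _ (b : bool) p =>
  (b :: p.1, if b then false :: p.2 else true :: p.1))) => //; try by pt.
exists (fun x => 8 * sz (f x) + 10); first by pbd_tac.
move=> x s1 s2 e.
set g := foldr _ _.
have [e1 e2] : (g s2).1 = s2 /\ size (g s2).2 <= (size s2).+1.
  split; last exact: size_bsucc.
  by rewrite /g; elim: (s2) => //= ? ? ->.
rewrite [g s2]surjective_pairing sz_pair e1.
have := sz_word s2; have := sz_word (g s2).2.
by pose proof (size_le_sz (f x)) as H; rewrite e size_cat in H *; lia.
Qed.

End PolySuccessor.

Section PolyAddition.
Context {X : Type} {eX : encodable X}.

Lemma pt_bits (n : X -> nat) : polyf n -> polyf (fun x => bits (n x)).
Proof.
move=> Hn.
have iterE k : iter k bsucc [::] = bits k by elim: k => //= k ->; rewrite bitsS.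
apply: polyf_ext (pt_iter Hn (polyf_const ([::] : seq bool))
  (f := fun _ => bsucc) _ _) => [x||].
- exact: iterE.
- by apply: pt_bsucc; pt.
exists (fun x => 4 * sz (n x) + 1); first by pbd_tac.
move=> x k le_k; rewrite iterE; apply: leq_trans (sz_word _) _.
by have := size_bits k; rewrite sz_nat; lia.
Qed.

Lemma pt_badd (f g : X -> seq bool) :
  polyf f -> polyf g -> polyf (fun x => badd (f x) (g x)).
Proof.
move=> Hf Hg.
have Hl : polyf (fun x => foldl badd_step (false, g x, [::]) (f x)).
  apply: (pt_foldl (f := fun _ => badd_step)) => //.
  - by pt.
  - by rewrite /badd_step /bmaj; pt.
  exists (fun x => sz (g x) + 4 * sz (f x) + 6); first by pbd_tac.
  move=> x s1 s2 e; have [] := foldl_badd_stepE s1 false (g x) [::].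
  case: (foldl _ _ _) => -[c t] out /= -> /eqP; rewrite addn0 => /eqP e2.
  rewrite !sz_pair.
  pose proof (sz_cat (take (size s1) (g x)) (drop (size s1) (g x))) as H.
  rewrite cat_take_drop in H.
  pose proof (sz_gt0 (take (size s1) (g x))).
  have := sz_word out; rewrite e2; have := sz_bool c.
  by pose proof (size_le_sz (f x)) as H1; rewrite e size_cat in H1 *; lia.
rewrite /badd /badd_end; apply: pt_cat; first by pt.
by apply: pt_if; [pt | apply: pt_bsucc; pt | pt].
Qed.

End PolyAddition.

Section PolyMultiplication.
Context {X : Type} {eX : encodable X}.

Lemma pt_bmul (f g : X -> seq bool) :
  polyf f -> polyf g -> polyf (fun x => bmul (f x) (g x)).
Proof.
move=> Hf Hg; rewrite /bmul.
apply: (pt_foldr (f := fun x b acc => badd (if b then g x else [::])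
  (false :: acc))) => //; first by pt.
  have Hg' : polyf (fun p : X * seq bool * bool => g p.1.1).
    by apply: (polyf_comp (f := fun p : X * seq bool * bool => p.1.1) _ Hg); pt.
  by apply: pt_badd; pt.
exists (fun x => 4 * (sz (g x) + 2 * sz (f x)) + 1); first by pbd_tac.
move=> x s1 s2 e; apply: leq_trans (sz_word _) _.
have := size_bmul s2 (g x); rewrite -/(bmul s2 (g x)).
pose proof (size_le_sz (g x)).
by pose proof (size_le_sz (f x)) as H1; rewrite e size_cat in H1 *; lia.
Qed.

Lemma pt_blt (f g : X -> seq bool) :
  polyf f -> polyf g -> polyf (fun x => blt (f x) (g x)).
Proof.
move=> Hf Hg.
have Hl : polyf (fun x => foldl blt_step (false, g x) (f x)).
  apply: (pt_foldl (f := fun _ => blt_step)) => //.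
  - by pt.
  - by rewrite /blt_step; pt.
  exists (fun x => sz (g x) + 4); first by pbd_tac.
  move=> x s1 s2 _.
  have e c t : (foldl blt_step (c, t) s1).2 = drop (size s1) t.
    elim: s1 c t => [|b s1 IH] c t /=; first by rewrite drop0.
    by rewrite IH; case: t.
  rewrite [foldl _ _ _]surjective_pairing sz_pair e.
  pose proof (sz_cat (take (size s1) (g x)) (drop (size s1) (g x))) as H.
  rewrite cat_take_drop in H.
  pose proof (sz_gt0 (take (size s1) (g x))).
  by have := sz_bool (foldl blt_step (false, g x) s1).1; lia.
by rewrite /blt; pt.
Qed.
End PolyMultiplication.

Ltac pt_extra ::=
  match goal with
  | |- polyf (fun x => bits (@?f x)) => apply: (pt_bits (n := f))
  | |- polyf (fun x => badd (@?f x) (@?g x)) => apply: (pt_badd (f := f) (g := g))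
  | |- polyf (fun x => bmul (@?f x) (@?g x)) => apply: (pt_bmul (f := f) (g := g))
  | |- polyf (fun x => blt (@?f x) (@?g x)) => apply: (pt_blt (f := f) (g := g))
  | |- polyf (fun x => delimit (@?f x)) => rewrite /delimit
  end.

(** * The verifier *)

(** The flag says that the marker [true] has just been read, so that the current bit is data. *)
Definition words_step (st : bool * seq bool * seq (seq bool)) (b : bool) :=
  if st.1.1 then (false, b :: st.1.2, st.2)
  else if b then (true, st.1.2, st.2) else (false, [::], rev st.1.2 :: st.2).

Definition words (w : seq bool) : seq (seq bool) :=
  rev (foldl words_step (false, [::], [::]) w).2.

Lemma foldl_words_acc u st acc :
  (foldl words_step (st, acc) u).2 =
  (foldl words_step (st, [::]) u).2 ++ acc.
Proof.
elim: u st acc => [//|b u IH] [[] c] acc /=; first exact: IH.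
case: b => /=; first exact: IH.
by rewrite IH [in RHS]IH -catA.
Qed.

Lemma words_delimit x u : words (delimit x ++ u) = x :: words u.
Proof.
rewrite /words /delimit -catA foldl_cat.
have -> c acc : foldl words_step (false, c, acc)
    (flatten [seq [:: true; b] | b <- x]) = (false, catrev x c, acc).
  by elim: x c => //= b x IH c; rewrite /words_step /=.
rewrite /= {2}/words_step /= catrevs0 revK foldl_words_acc.
by rewrite rev_cat.
Qed.

Lemma size_delimit x : size (delimit x) = 2 * size x + 1.
Proof.
rewrite /delimit size_cat /=; congr (_ + _).
by elim: x => //= b x ->; lia.
Qed.

(* A nonnegative entry is a false sign bit, which reads as the delimited       *)
(* empty word, followed by two delimited words.                               *)
Definition chunk_step (w : seq bool)
    (st : seq (seq bool) * seq (seq bool * seq bool)) :=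
  if size st.1 == 2
  then ([::], (head [::] st.1, head [::] (behead st.1)) :: st.2)
  else (w :: st.1, st.2).

Definition chunks (W : seq (seq bool)) : seq (seq bool * seq bool) :=
  (foldr chunk_step ([::], [::]) W).2.

Definition encode_entry (e : seq bool * seq bool) : seq bool :=
  false :: delimit e.1 ++ delimit e.2.

Definition entries (x : seq bool) := chunks (behead (words x)).

Lemma words_entries m es :
  words (delimit m ++ flatten [seq encode_entry e | e <- es]) =
  m :: flatten [seq [:: [::]; e.1; e.2] | e <- es].
Proof.
rewrite words_delimit; congr (_ :: _); elim: es => //= e es IH.
rewrite -[false :: _]/(delimit [::] ++ _) words_delimit -catA !words_delimit.
by rewrite IH.
Qed.

Lemma entriesK m es :
  entries (delimit m ++ flatten [seq encode_entry e | e <- es]) = es.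
Proof.
rewrite /entries words_entries /= /chunks.
suff -> : foldr chunk_step ([::], [::])
    (flatten [seq [:: [::]; e.1; e.2] | e <- es]) = ([::], es) by [].
by elim: es => //= -[a b] es ->.
Qed.

(* [entries] returns junk on words that encode no point, hence the             *)
(* comparison with the re-encoded word.                                       *)
Definition well_formed (n : nat) (x : seq bool) : bool :=
  [&& x == delimit (bits n) ++ flatten [seq encode_entry e | e <- entries x],
      size (entries x) == n * n * (n * n)
    & all (fun e => [&& canonical e.1, canonical e.2 & ~~ nilp e.2])
          (entries x)].

Definition square_index (n : nat) : seq (nat * nat) :=
  [seq (i, j) | i <- iota 0 n, j <- iota 0 n].

Definition quad_index (n : nat) : seq ((nat * nat) * (nat * nat)) :=
  [seq (p, q) | p <- square_index n, q <- square_index n].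

(** Fractions are not reduced. The accumulator is the second factor of every product, the one that
    [size_bmul] counts only once, so its length grows additively and stays linear in the size of the
    list. *)
Definition frac_sum (l : seq (seq bool * seq bool)) : seq bool * seq bool :=
  foldl (fun nd e => (badd (bmul e.2 nd.1) (bmul e.1 nd.2), bmul e.2 nd.2))
        ([::], [:: true]) l.

Definition in_rect (pv qv : seq bool) (p : nat * nat) : bool :=
  nth false pv p.1 && nth false qv p.2.

Definition diag_entries n es pv qv : seq (seq bool * seq bool) :=
  [seq e.2 | e <- [seq e <- zip (quad_index n) es |
     [&& e.1.1.1 == e.1.2.1, e.1.1.2 == e.1.2.2 & in_rect pv qv e.1.1]]].

Definition off_entries n es pv qv : seq (seq bool * seq bool) :=
  [seq e.2 | e <- [seq e <- zip (quad_index n) es |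
     [&& in_rect pv qv e.1.1, in_rect pv qv e.1.2 & e.1.1.1 < e.1.2.1]]].

Definition admissible_sizes (n a b beta : nat) : bool :=
  [&& beta + 1 <= a, beta + 1 <= b, a + 3 <= n, b + 3 <= n,
      a + b + 3 <= n + beta & 2 <= beta].

(* Both sides are multiplied by twice the two denominators.                    *)
Definition exceeds (beta : nat) (S1 S2 : seq bool * seq bool) : bool :=
  blt (badd (bmul (bits 2) (bmul S2.1 S1.2))
            (bmul (bits (beta * beta.-1)) (bmul S1.2 S2.2)))
      (bmul (bits (2 * beta.-1)) (bmul S1.1 S2.2)).

(** The certificate [us] lists the indicator words of P and Q, then a word whose length is beta. *)
Definition violated (n : nat) (es : seq (seq bool * seq bool))
    (us : seq (seq bool)) : bool :=
  admissible_sizes n (count (fun i => nth false (nth [::] us 0) i) (iota 0 n))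
    (count (fun i => nth false (nth [::] us 1) i) (iota 0 n))
    (size (nth [::] us 2))
  && exceeds (size (nth [::] us 2))
       (frac_sum (diag_entries n es (nth [::] us 0) (nth [::] us 1)))
       (frac_sum (off_entries n es (nth [::] us 0) (nth [::] us 1))).

(** The dimension is found by exhaustive search; it never exceeds the length of the word, by
    [encode_point_size]. *)
Definition verify_pair (x : seq bool) (us : seq (seq bool)) : bool :=
  ~~ has (fun n => well_formed n x) (iota 0 (size x).+1)
  || has (fun n => well_formed n x && violated n (entries x) us)
         (iota 0 (size x).+1).

Definition verify (w : seq bool) : bool :=
  verify_pair (head [::] (words w)) (behead (words w)).

(** * The verifier runs in polynomial time *)

Section VerifierPoly.
Context {X : Type} {eX : encodable X}.

Lemma pt_words (f : X -> seq bool) : polyf f -> polyf (fun x => words (f x)).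
Proof.
move=> Hf; rewrite /words; apply: pt_rev; apply: pt_snd.
apply: (pt_foldl (f := fun _ => words_step)) => //; try by pt.
  by rewrite /words_step; pt.
exists (fun x => 4 * sz (f x) + 10); first by pbd_tac.
move=> x s1 s2 e.
have H p c acc : sz (foldl words_step (p, c, acc) s1).1.2 +
    sz (foldl words_step (p, c, acc) s1).2 <= sz c + sz acc + 4 * size s1.
  elim: s1 p c acc {e} => [|b s1 IH] p c acc; first by rewrite /= muln0 addn0.
  case: p => /=.
    by apply: leq_trans (IH _ _ _) _; rewrite sz_cons /=; have := sz_bool b; lia.
  case: b => /=; first by apply: leq_trans (IH _ _ _) _; rewrite /=; lia.
  apply: leq_trans (IH _ _ _) _.
  by rewrite /= sz_nil sz_cons sz_rev; lia.
have := H false [::] [::]; rewrite !sz_nil.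
case: (foldl _ _ _) => -[p c] acc /=; rewrite !sz_pair.
have := sz_bool p.
by pose proof (size_le_sz (f x)) as H1; rewrite e size_cat in H1 *; lia.
Qed.

Lemma pt_chunks (f : X -> seq (seq bool)) :
  polyf f -> polyf (fun x => chunks (f x)).
Proof.
move=> Hf; rewrite /chunks; apply: pt_snd.
apply: (pt_foldr (f := fun _ => chunk_step)) => //; try by pt.
  by rewrite /chunk_step; pt.
exists (fun x => sz (f x) + 3); first by pbd_tac.
move=> x s1 s2 e.
have H : sz (foldr chunk_step ([::], [::]) s2).1 +
         sz (foldr chunk_step ([::], [::]) s2).2 <= sz s2 + 1.
  elim: s2 {e} => [//|w s2 IH]; rewrite [foldr _ _ _]/= {1 3}/chunk_step.
  move: IH; case: (foldr _ _ _) => c acc /=; case: eqP => [|_] /=.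
    case: c => [//|a [//|b [|//]]] _; rewrite !sz_cons !sz_nil sz_pair /=; lia.
  by rewrite !sz_cons; lia.
rewrite [foldr _ _ _]surjective_pairing sz_pair.
pose proof (sz_cat s1 s2) as H1; pose proof (sz_gt0 s1).
by rewrite e; lia.
Qed.

Lemma pt_frac_sum (f : X -> seq (seq bool * seq bool)) :
  polyf f -> polyf (fun x => frac_sum (f x)).
Proof.
move=> Hf; rewrite /frac_sum.
apply: (pt_foldl (f := fun _ nd e =>
  (badd (bmul e.2 nd.1) (bmul e.1 nd.2), bmul e.2 nd.2))) => //; try by pt.
exists (fun x => 16 * sz (f x) + 20); first by pbd_tac.
move=> x s1 s2 e; set g := (g in foldl g).
have H st : maxn (size (foldl g st s1).1) (size (foldl g st s1).2) <=
    maxn (size st.1) (size st.2) + 2 * sz s1.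
  elim: s1 st {e} => [|a s1 IH] st /=; first by lia.
  apply: leq_trans (IH _) _; rewrite sz_cons /g /=.
  have := size_badd (bmul a.2 st.1) (bmul a.1 st.2).
  have := size_bmul a.2 st.1; have := size_bmul a.1 st.2.
  have := size_bmul a.2 st.2.
  case: a => u v; rewrite sz_pair /=.
  by pose proof (size_le_sz u); pose proof (size_le_sz v); lia.
have := H ([::], [:: true]).
rewrite [foldl _ _ _ in X in _ -> X]surjective_pairing sz_pair /=.
set r := foldl _ _ _.
have := sz_word r.1; have := sz_word r.2.
pose proof (sz_cat s1 s2) as H1; pose proof (sz_gt0 s2).
by rewrite e; lia.
Qed.

Lemma pt_last (f : X -> seq bool) : polyf f -> polyf (fun x => last true (f x)).
Proof.
move=> Hf; apply: polyf_ext (pt_head true (pt_rev Hf)) => x.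
by case/lastP: (f x) => // s a; rewrite rev_rcons last_rcons.
Qed.
End VerifierPoly.

Ltac pt_extra ::=
  match goal with
  | |- polyf (fun x => bits (@?f x)) => apply: (pt_bits (n := f))
  | |- polyf (fun x => badd (@?f x) (@?g x)) => apply: (pt_badd (f := f) (g := g))
  | |- polyf (fun x => bmul (@?f x) (@?g x)) => apply: (pt_bmul (f := f) (g := g))
  | |- polyf (fun x => blt (@?f x) (@?g x)) => apply: (pt_blt (f := f) (g := g))
  | |- polyf (fun x => words (@?f x)) => apply: (pt_words (f := f))
  | |- polyf (fun x => chunks (@?f x)) => apply: (pt_chunks (f := f))
  | |- polyf (fun x => frac_sum (@?f x)) => apply: (pt_frac_sum (f := f))
  | |- polyf (fun x => last true (@?f x)) => apply: (pt_last (f := f))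
  | |- polyf (fun x => delimit (@?f x)) => rewrite /delimit
  end.

Lemma polyf_entries : polyf entries.
Proof. by rewrite /entries; pt. Qed.

Lemma polyf_well_formed :
  polyf (fun p : nat * seq bool => well_formed p.1 p.2).
Proof.
have He : polyf (fun p : nat * seq bool => entries p.2).
  by apply: (polyf_comp _ polyf_entries); pt.
by rewrite /well_formed /encode_entry /canonical; pt.
Qed.

Lemma polyf_quad_index : polyf quad_index.
Proof. by rewrite /quad_index /square_index; pt. Qed.

Lemma polyf_violated :
  polyf (fun p : nat * seq (seq bool * seq bool) * seq (seq bool) =>
           violated p.1.1 p.1.2 p.2).
Proof.
have Hq : polyf (fun p : nat * seq (seq bool * seq bool) * seq (seq bool) =>
                   quad_index p.1.1).
  by apply: (polyf_comp _ polyf_quad_index); pt.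
have Hd : polyf (fun p : nat * seq (seq bool * seq bool) * seq (seq bool) =>
   frac_sum (diag_entries p.1.1 p.1.2 (nth [::] p.2 0) (nth [::] p.2 1))).
  by rewrite /diag_entries /in_rect; pt.
have Ho : polyf (fun p : nat * seq (seq bool * seq bool) * seq (seq bool) =>
   frac_sum (off_entries p.1.1 p.1.2 (nth [::] p.2 0) (nth [::] p.2 1))).
  by rewrite /off_entries /in_rect; pt.
by rewrite /violated /admissible_sizes /exceeds; pt.
Qed.

Lemma polyf_verify : polyf verify.
Proof.
have H : polyf (fun p : seq bool * seq (seq bool) => verify_pair p.1 p.2).
  have Hw : polyf (fun p : seq bool * seq (seq bool) * nat =>
                     well_formed p.2 p.1.1).
    by apply: (polyf_comp (f := fun p : seq bool * seq (seq bool) * nat =>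
      (p.2, p.1.1)) _ polyf_well_formed); pt.
  have Hv : polyf (fun p : seq bool * seq (seq bool) * nat =>
                     violated p.2 (entries p.1.1) p.1.2).
    apply: (polyf_comp (f := fun p : seq bool * seq (seq bool) * nat =>
      (p.2, entries p.1.1, p.1.2)) _ polyf_violated).
    have : polyf (fun p : seq bool * seq (seq bool) * nat => entries p.1.1).
      by apply: (polyf_comp _ polyf_entries); pt.
    by move=> He; pt.
  by rewrite /verify_pair; pt.
apply: (polyf_comp (f := fun w => (head [::] (words w), behead (words w))) _ H).
by pt.
Qed.

(** * Correctness of the verifier *)

Definition nat_pair n (p : 'I_n * 'I_n) : nat * nat := (val p.1, val p.2).

Definition quad_ord n : seq (('I_n * 'I_n) * ('I_n * 'I_n)) :=
  [seq (p, q) | p <- row_major n, q <- row_major n].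

Definition point_entry n (num : point int n) (den : point nat n)
    (pq : ('I_n * 'I_n) * ('I_n * 'I_n)) : seq bool * seq bool :=
  (bits `|num pq.1 pq.2|, bits (den pq.1 pq.2)).

Lemma square_indexE n : square_index n = [seq nat_pair p | p <- row_major n].
Proof.
rewrite /square_index /row_major map_allpairs -val_enum_ord.
by rewrite allpairs_mapl allpairs_mapr.
Qed.

Lemma quad_indexE n :
  quad_index n = [seq (nat_pair pq.1, nat_pair pq.2) | pq <- quad_ord n].
Proof.
by rewrite /quad_index /quad_ord map_allpairs square_indexE allpairs_mapl
  allpairs_mapr.
Qed.

Lemma size_quad_ord n : size (quad_ord n) = n * n * (n * n).
Proof. by rewrite !size_allpairs size_enum_ord. Qed.

Lemma uniq_row_major n : uniq (row_major n).
Proof. by apply: allpairs_uniq; rewrite ?enum_uniq // => -[? ?] [? ?]. Qed.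

Lemma uniq_quad_ord n : uniq (quad_ord n).
Proof. by apply: allpairs_uniq; rewrite ?uniq_row_major // => -[? ?] [? ?]. Qed.

Lemma mem_row_major n p : p \in row_major n.
Proof. by case: p => i j; apply/allpairsP; exists (i, j); rewrite !mem_enum. Qed.

Lemma mem_quad_ord n p : p \in quad_ord n.
Proof. by case: p => i j; apply/allpairsP; exists (i, j); rewrite !mem_row_major. Qed.

Lemma encode_pointE n (num : point int n) (den : point nat n) :
  (forall p q, 0 <= num p q)%R ->
  encode_point num den = delimit (bits n) ++
    flatten [seq encode_entry e | e <- [seq point_entry num den pq | pq <- quad_ord n]].
Proof.
move=> num_ge0; rewrite /encode_point /encode_nat; congr (_ ++ flatten _).
rewrite -map_comp /quad_ord map_allpairs; apply: eq_allpairs => p q.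
by rewrite /encode_int ltNge num_ge0.
Qed.

Lemma fraction_ge0 n (num : point int n) (den : point nat n) p q :
  0 < den p q -> (0 <= fraction_point num den p q)%R = (0 <= num p q)%R.
Proof.
move=> den_gt0; rewrite /fraction_point pmulr_lge0 ?ler0z //.
by rewrite invr_gt0 ltr0n.
Qed.

Lemma well_formed_encode n (num : point int n) (den : point nat n) :
  (forall p q, 0 < den p q) -> (forall p q, 0 <= num p q)%R ->
  well_formed n (encode_point num den) /\
  entries (encode_point num den) = [seq point_entry num den pq | pq <- quad_ord n].
Proof.
move=> den_gt0 num_ge0.
have e : entries (encode_point num den) =
         [seq point_entry num den pq | pq <- quad_ord n].
  by rewrite encode_pointE // entriesK.
split=> //; rewrite /well_formed e; apply/and3P; split.
- by rewrite encode_pointE.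
- by rewrite size_map size_quad_ord.
rewrite all_map; apply/allP => pq _ /=; rewrite !canonical_bits /=.
by have := den_gt0 pq.1 pq.2; case: (den _ _) => // m _; rewrite bits_pos.
Qed.

(** A canonical word is the [bits] of its value, so decoding the entries and encoding them again
    restores the word; a nonempty canonical denominator is positive. *)
Lemma well_formedP n x : well_formed n x ->
  exists num : point int n, exists den : point nat n,
  [/\ x = encode_point num den, forall p q, 0 < den p q
    & forall p q, (0 <= num p q)%R].
Proof.
case/and3P => /eqP ex /eqP size_es all_es.
set es := entries x in ex size_es all_es.
pose e p q := nth ([::], [::]) es (index (p, q) (quad_ord n)).
have e_es p q : e p q \in es.
  by rewrite mem_nth // size_es -size_quad_ord index_mem mem_quad_ord.
exists (fun p q => Posz (word_val (e p q).1)), (fun p q => word_val (e p q).2).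
split=> // [|p q]; last first.
  have /and3P[_ c2] := allP all_es _ (e_es p q).
  rewrite lt0n; apply: contra => /eqP v0.
  by rewrite -(bits_word_val c2) v0.
rewrite encode_pointE // {1}ex; congr (_ ++ flatten _).
have -> : es = [seq e pq.1 pq.2 | pq <- quad_ord n].
  apply: (@eq_from_nth _ ([::], [::])); first by rewrite size_map size_quad_ord.
  move=> i lt_i; rewrite size_es -size_quad_ord in lt_i.
  (* A default for [nth] exists only because the list is nonempty: for n = 0 the index type is
     empty. *)
  have [pq0 _] : exists pq0, pq0 \in quad_ord n.
    by case: (quad_ord n) lt_i => // pq0 s _; exists pq0; rewrite mem_head.
  rewrite (nth_map pq0) // /e -surjective_pairing index_uniq //.
  exact: uniq_quad_ord.
rewrite -!map_comp; apply: eq_map => -[p q] /=; congr (encode_entry _).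
have /and3P[c1 c2 _] := allP all_es _ (e_es p q).
by rewrite /point_entry /= !bits_word_val // -surjective_pairing.
Qed.

Lemma size_flatten_ge T (ss : seq (seq T)) :
  all (fun s => 0 < size s) ss -> size ss <= size (flatten ss).
Proof. by elim: ss => //= s ss IH /andP[? /IH]; rewrite size_cat; lia. Qed.

Lemma encode_point_size n (num : point int n) (den : point nat n) :
  n <= size (encode_point num den).
Proof.
rewrite /encode_point size_cat; apply: leq_trans (leq_addl _ _).
apply: leq_trans (size_flatten_ge _); last first.
  by apply/allP => _ /allpairsP[[p q] [_ _ ->]].
rewrite !size_allpairs size_enum_ord; case: n num den => // n _ _; lia.
Qed.

Lemma frac_sumE (l : seq (seq bool * seq bool)) :
  all (fun e => 0 < word_val e.2) l ->
  0 < word_val (frac_sum l).2 /\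
  ((word_val (frac_sum l).1)%:R / (word_val (frac_sum l).2)%:R =
   \sum_(e <- l) (word_val e.1)%:R / (word_val e.2)%:R :> rat)%R.
Proof.
rewrite /frac_sum; set g := (g in foldl g).
have gen nd : all (fun e => 0 < word_val e.2) l -> 0 < word_val nd.2 ->
  0 < word_val (foldl g nd l).2 /\
  ((word_val (foldl g nd l).1)%:R / (word_val (foldl g nd l).2)%:R =
   (word_val nd.1)%:R / (word_val nd.2)%:R +
   \sum_(e <- l) (word_val e.1)%:R / (word_val e.2)%:R :> rat)%R.
  elim: l nd => [|e l IH] nd /=; first by rewrite big_nil addr0.
  case/andP => e_gt0 Hl nd_gt0; have [|-> ->] := IH (g nd e) Hl.
    by rewrite /g /= word_val_bmul muln_gt0 e_gt0.
  split=> //; rewrite big_cons addrA; congr (_ + _)%R.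
  rewrite /g /= word_val_badd !word_val_bmul natrD !natrM.
  have ne1 : ((word_val e.2)%:R != 0 :> rat)%R by rewrite pnatr_eq0 -lt0n.
  have ne2 : ((word_val nd.2)%:R != 0 :> rat)%R by rewrite pnatr_eq0 -lt0n.
  by field; rewrite ne1.
move=> Hl; have [//|-> ->] := gen ([::], [:: true]) Hl.
by split=> //=; rewrite mul0r add0r.
Qed.

Lemma exceedsE beta (S1 S2 : seq bool * seq bool) (s1 s2 : rat) :
  0 < beta -> 0 < word_val S1.2 -> 0 < word_val S2.2 ->
  ((word_val S1.1)%:R / (word_val S1.2)%:R = s1)%R ->
  ((word_val S2.1)%:R / (word_val S2.2)%:R = s2)%R ->
  exceeds beta S1 S2 =
  ~~ ((beta%:R - 1) * s1 - s2 <= (beta%:R ^+ 2 - beta%:R) / 2%:R)%R.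
Proof.
case: beta => // b _ D1 D2 <- <-; rewrite /exceeds bltE.
rewrite !(word_val_badd, word_val_bmul, word_val_bits) /=.
move: (word_val S1.1) (word_val S1.2) (word_val S2.1) (word_val S2.2) D1 D2
  => n1 d1 n2 d2 D1 D2.
rewrite -ltNge -(ltr_nat rat) !(natrD, natrM).
have p1 : (0 < d1%:R :> rat)%R by rewrite ltr0n.
have p2 : (0 < d2%:R :> rat)%R by rewrite ltr0n.
rewrite -subr_gt0 -[in RHS]subr_gt0.
set L := (X in (0 < X)%R = _); set R := (X in _ = (0 < X)%R).
have -> : R = (L / (2%:R * d1%:R * d2%:R))%R.
  rewrite /R /L -natr1; field.
  by rewrite !gt_eqF.
by rewrite pmulr_lgt0 // invr_gt0 !mulr_gt0.
Qed.

Lemma count_iota_card n (pv : seq bool) :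
  count (fun i => nth false pv i) (iota 0 n) = #|[set i : 'I_n | nth false pv i]|.
Proof.
rewrite -val_enum_ord count_map cardE size_filter enumT.
by apply: eq_count => i; rewrite /= inE.
Qed.

Lemma sum_row_major n (F : 'I_n * 'I_n -> rat) (C : pred ('I_n * 'I_n)) :
  (\sum_(p <- row_major n | C p) F p = \sum_(p | C p) F p)%R.
Proof.
apply: perm_big; apply: uniq_perm; rewrite ?uniq_row_major ?index_enum_uniq //.
by move=> p; rewrite mem_row_major mem_index_enum.
Qed.

Section PointViolation.
Variables (n : nat) (num : point int n) (den : point nat n).
Hypothesis den_gt0 : forall p q, 0 < den p q.
Hypothesis num_ge0 : forall p q, (0 <= num p q)%R.
Variables pv qv : seq bool.
Let P := [set i : 'I_n | nth false pv i].
Let Q := [set i : 'I_n | nth false qv i].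
Let es := [seq point_entry num den pq | pq <- quad_ord n].
Let Y := fraction_point num den.

Lemma in_rectE p : in_rect pv qv (nat_pair p) = (p \in setX P Q).
Proof. by rewrite !inE. Qed.

Lemma zip_quad : zip (quad_index n) es =
  [seq ((nat_pair pq.1, nat_pair pq.2), point_entry num den pq)
  | pq <- quad_ord n].
Proof. by rewrite quad_indexE /es; elim: (quad_ord n) => //= a s ->. Qed.

Lemma entry_value pq : ((word_val (point_entry num den pq).1)%:R /
  (word_val (point_entry num den pq).2)%:R = Y pq.1 pq.2 :> rat)%R.
Proof.
rewrite /= !word_val_bits /Y /fraction_point; congr (_ / _)%R.
by rewrite pmulrn gez0_abs.
Qed.

Lemma sum_selected (C : pred (((nat * nat) * (nat * nat)) * (seq bool * seq bool)))
    (D : pred (('I_n * 'I_n) * ('I_n * 'I_n))) :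
  (forall pq, C ((nat_pair pq.1, nat_pair pq.2), point_entry num den pq) = D pq) ->
  let S := frac_sum [seq e.2 | e <- [seq e <- zip (quad_index n) es | C e]] in
  0 < word_val S.2 /\
  ((word_val S.1)%:R / (word_val S.2)%:R =
   \sum_p \sum_(q | D (p, q)) Y p q :> rat)%R.
Proof.
move=> CD; rewrite zip_quad filter_map -map_comp.
set l := [seq pq <- _ | _].
have [] := @frac_sumE [seq point_entry num den i | i <- l].
  by rewrite all_map; apply/allP => pq _; rewrite /= word_val_bits.
move=> S_gt0 SE; split=> //=; rewrite {}SE big_map /l big_filter.
rewrite /quad_ord big_mkcond big_allpairs sum_row_major; apply: eq_bigr => p _.
rewrite sum_row_major [RHS]big_mkcond; apply: eq_bigr => q _.
by rewrite -(CD (p, q)) -(entry_value (p, q)).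
Qed.

Lemma violatedE us : nth [::] us 0 = pv -> nth [::] us 1 = qv ->
  violated n es us <-> admissible P Q (size (nth [::] us 2)) /\
                       ~ PQ_inequality P Q (size (nth [::] us 2)) Y.
Proof.
move=> e0 e1; rewrite /violated e0 e1 !count_iota_card -/P -/Q.
set beta := size _.
have admE : admissible_sizes n #|P| #|Q| beta <-> admissible P Q beta.
  rewrite /admissible_sizes; split.
    by case/and5P=> ? ? ? ? /andP[].
  by case=> -[? ?] [? ?] ? ?; apply/and5P; split=> //; apply/andP.
have [|g1 s1] := @sum_selected
  (fun e => [&& e.1.1.1 == e.1.2.1, e.1.1.2 == e.1.2.2 & in_rect pv qv e.1.1])
  (fun pq => (pq.1 == pq.2) && (pq.1 \in setX P Q)).
  by case=> -[i j] [k l]; rewrite in_rectE -pair_eqE /= -!val_eqE -andbA.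
have [|g2 s2] := @sum_selected
  (fun e => [&& in_rect pv qv e.1.1, in_rect pv qv e.1.2 & e.1.1.1 < e.1.2.1])
  (fun pq => [&& pq.1 \in setX P Q, pq.2 \in setX P Q & pq.1.1 < pq.2.1]).
  by case=> p q /=; rewrite !in_rectE.
have s1E : (\sum_p \sum_(q | (p == q) && (p \in setX P Q)) Y p q =
            \sum_(p in setX P Q) Y p p)%R.
  rewrite [RHS]big_mkcond; apply: eq_bigr => p _.
  case: ifP => _; last by rewrite big_pred0 // => q; rewrite andbF.
  by rewrite (big_pred1 p) // => q; rewrite andbT eq_sym.
have s2E : (\sum_p \sum_(q | [&& p \in setX P Q, q \in setX P Q & (p.1 < q.1)%N]) Y p q =
   \sum_(p in setX P Q) \sum_(q in setX P Q | (p.1 < q.1)%N) Y p q)%R.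
  rewrite [RHS]big_mkcond; apply: eq_bigr => p _.
  by case: ifP => _ //=; rewrite big_pred0.
rewrite /= in s1 s2; rewrite {}s1E in s1; rewrite {}s2E in s2.
split.
  case/andP=> /admE adm; have beta_gt0 : 0 < beta by case: adm => _ _ _; lia.
  by rewrite (exceedsE beta_gt0 g1 g2 s1 s2) => /negP.
case=> adm; have beta_gt0 : 0 < beta by case: adm => _ _ _; lia.
move=> nineq; apply/andP; split; first exact/admE.
by rewrite (exceedsE beta_gt0 g1 g2 s1 s2); apply/negP.
Qed.
End PointViolation.

Lemma verify_delimit x u : verify (delimit x ++ u) = verify_pair x (words u).
Proof. by rewrite /verify words_delimit. Qed.

Lemma verify_sound x u : verify (delimit x ++ u) -> ~ PQ_language x.
Proof.
rewrite verify_delimit => Hv [n [num [den [ex den_gt0 Y_ge0 HY]]]].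
have num_ge0 p q : (0 <= num p q)%R by rewrite -(fraction_ge0 _ (den_gt0 p q)).
have [wf es] := well_formed_encode den_gt0 num_ge0; rewrite -ex in wf es.
move: Hv; rewrite /verify_pair.
have -> : has (fun m => well_formed m x) (iota 0 (size x).+1).
  apply/hasP; exists n => //.
  by rewrite mem_iota /= ltnS ex encode_point_size.
case/hasP => m _ /andP[wfm viol].
(* The first delimited word determines the dimension. *)
have emn : m = n.
  apply: bits_inj; case/and3P: wfm => /eqP e1 _ _.
  have := congr1 (head [::] \o words) e1.
  by rewrite /= words_entries {1}ex encode_pointE // words_delimit /= => ->.
subst m; rewrite es in viol.
by case/(violatedE den_gt0 num_ge0 erefl erefl): viol => adm; apply; exact: HY.
Qed.

Definition word_of_set n (A : {set 'I_n}) : seq bool :=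
  [seq i \in A | i <- enum 'I_n].

Lemma size_word_of_set n (A : {set 'I_n}) : size (word_of_set A) = n.
Proof. by rewrite size_map size_enum_ord. Qed.

Lemma set_of_word n (A : {set 'I_n}) :
  [set i : 'I_n | nth false (word_of_set A) i] = A.
Proof.
apply/setP => i; rewrite inE (nth_map i) ?size_enum_ord //.
by rewrite nth_ord_enum.
Qed.

(** The three delimited words have lengths 2n+1, 2n+1 and 2 beta+1, where beta <= n and n is at most
    the length of the encoding. *)
Lemma violation_not_PQ n (num : point int n) (den : point nat n)
    (P Q : {set 'I_n}) beta :
  (forall p q, 0 < den p q) -> (forall p q, 0 <= num p q)%R ->
  admissible P Q beta -> ~ PQ_inequality P Q beta (fraction_point num den) ->
  exists u, size u <= 6 * size (encode_point num den) + 3 /\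
            verify (delimit (encode_point num den) ++ u).
Proof.
move=> den_gt0 num_ge0 adm nineq.
exists (delimit (word_of_set P) ++ delimit (word_of_set Q) ++
        delimit (nseq beta true)).
have le_n := encode_point_size num den.
split.
  rewrite size_cat size_delimit size_cat !size_delimit !size_word_of_set.
  rewrite size_nseq.
  case: adm => -[? ?] [? ?] ? ?; lia.
rewrite verify_delimit !words_delimit.
have -> : words (delimit (nseq beta true)) = [:: nseq beta true].
  by rewrite -[delimit _]cats0 words_delimit.
have [wf es] := well_formed_encode den_gt0 num_ge0.
apply/orP; right; apply/hasP; exists n; first by rewrite mem_iota /= ltnS.
rewrite wf es /=; apply/(violatedE den_gt0 num_ge0 erefl erefl).
by rewrite !set_of_word /= size_nseq.
Qed.

Theorem PQ_in_coNP : in_coNP PQ_language.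
Proof.
exists verify, (6%:R *: 'X + 3%:P)%R; split.
  apply: polyf_polytime; apply: pt_cons; first exact: polyf_verify.
  exact: polyf_const.
move=> x; split; last by case=> u [_ /verify_sound].
move=> notL; rewrite hornerD hornerZ hornerX hornerC.
have [wf|nwf] := boolP (has (fun m => well_formed m x) (iota 0 (size x).+1)).
  case/hasP: wf => n _ /well_formedP[num [den [ex den_gt0 num_ge0]]].
  have [[P [Q [beta [adm nineq]]]]|noviol] :=
    classic (exists P : {set 'I_n}, exists Q : {set 'I_n}, exists beta,
      admissible P Q beta /\ ~ PQ_inequality P Q beta (fraction_point num den)).
    by rewrite ex; exact: violation_not_PQ adm nineq.
  case: notL; exists n, num, den; split=> // [p q|P Q beta adm].
    by rewrite fraction_ge0.
  by apply: NNPP => nineq; apply: noviol; exists P, Q, beta.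
(* Ill-formed words are rejected by the language, so the verifier accepts them with the empty
   certificate. *)
by exists [::]; split=> //; rewrite verify_delimit /verify_pair nwf.
Qed.

(** * From independent sets to violated inequalities *)

Section GraphPoint.
Variables (N K : nat) (conf : nat -> nat -> bool).
Hypothesis K_ge3 : 3 <= K.
(** The smallest n for which |P| = N, |Q| = 3 and beta = 2 satisfy |P| + |Q| + 3 <= n + beta. *)
Let n := N + 4.

Definition graph_entry (p q : nat * nat) : nat :=
  if (p.2 == 0) && (q.2 == 0) then
    if p.1 == q.1 then (if p.1 < N then 1 else 0)
    else if [&& p.1 < q.1, q.1 < N & conf p.1 q.1]
         then (N + 4) * (N + 4) else 0
  else 0.

Definition graph_num : point int n :=
  fun p q => Posz (graph_entry (nat_pair p) (nat_pair q)).

Definition graph_den : point nat n := fun _ _ => K.-1.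

Definition independent (I : {set 'I_n}) : Prop :=
  (forall i, i \in I -> i < N) /\
  (forall i k, i \in I -> k \in I -> i < k -> ~~ conf i k).

Let A (P Q : {set 'I_n}) :=
  \sum_(p in setX P Q) graph_entry (nat_pair p) (nat_pair p).
Let B (P Q : {set 'I_n}) :=
  \sum_(p in setX P Q) \sum_(q in setX P Q | p.1 < q.1)
    graph_entry (nat_pair p) (nat_pair q).

Lemma graph_inequality P Q beta : 0 < beta ->
  PQ_inequality P Q beta (fraction_point graph_num graph_den) <->
  2 * beta.-1 * A P Q <= 2 * B P Q + beta * beta.-1 * K.-1.
Proof.
case: beta => // b _.
have K_gt0 : (0 < K.-1%:R :> rat)%R by rewrite ltr0n; lia.
have YE p q : (fraction_point graph_num graph_den p q =
    (graph_entry (nat_pair p) (nat_pair q))%:R / K.-1%:R)%R.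
  by rewrite /fraction_point /graph_num -pmulrn.
rewrite /PQ_inequality.
have -> : (\sum_(p in setX P Q) fraction_point graph_num graph_den p p =
           (A P Q)%:R / K.-1%:R)%R.
  rewrite /A natr_sum mulr_suml; apply: eq_bigr => p _; exact: YE.
have -> : (\sum_(p in setX P Q) \sum_(q in setX P Q | (p.1 < q.1)%N)
             fraction_point graph_num graph_den p q =
           (B P Q)%:R / K.-1%:R)%R.
  rewrite /B natr_sum mulr_suml; apply: eq_bigr => p _.
  rewrite natr_sum mulr_suml; apply: eq_bigr => q _; exact: YE.
suff -> : ((b.+1%:R - 1) * ((A P Q)%:R / K.-1%:R) - (B P Q)%:R / K.-1%:R <=
    (b.+1%:R ^+ 2 - b.+1%:R) / 2%:R :> rat)%R =
    (2 * b.+1.-1 * A P Q <= 2 * B P Q + b.+1 * b.+1.-1 * K.-1) by [].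
rewrite -(ler_nat rat) !(natrD, natrM) /= -[in LHS]subr_ge0 -[in RHS]subr_ge0.
set L := (X in (0 <= X)%R = _); set R := (X in _ = (0 <= X)%R).
have -> : R = (L * (2%:R * K.-1%:R))%R.
  by rewrite /R /L -natr1; field; rewrite gt_eqF.
by rewrite pmulr_lge0 // mulr_gt0.
Qed.

Let o0 : 'I_n := @Ordinal n 0 (ltn_addl _ (isT : 0 < 4)).

Lemma graph_diag P Q :
  A P Q = if o0 \in Q then #|[set i in P | i < N]| else 0.
Proof.
rewrite /A.
have -> : \sum_(p in setX P Q) graph_entry (nat_pair p) (nat_pair p) =
    \sum_(i in P) \sum_(j in Q) ((j == o0) && (i < N)).
  rewrite pair_big /=; apply: eq_big => [p|p _]; first by rewrite !inE.
  by rewrite /graph_entry /= andbb eqxx -val_eqE /=; case: eqP; case: (_ < N).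
case: ifP => HQ; last first.
  rewrite big1 // => i _; rewrite big1 // => j jQ.
  by case: eqP => // ej; rewrite -ej jQ in HQ.
rewrite -sum1_card [RHS](eq_bigl (fun i => (i \in P) && (i < N))); last first.
  by move=> i; rewrite !inE.
rewrite [RHS]big_mkcondr /=; apply: eq_bigr => i iP.
rewrite (bigD1 o0) //= big1 ?addn0; last by move=> j /andP[_ /negPf->].
by case: (i < N).
Qed.

Lemma graph_conflict (P Q : {set 'I_n}) (i k : 'I_n) : o0 \in Q -> i \in P -> k \in P ->
  i < k -> k < N -> conf i k -> n * n <= B P Q.
Proof.
move=> HQ iP kP lt_ik lt_k Hc; rewrite /B.
rewrite (bigD1 (i, o0)) /=; last by rewrite in_setX iP HQ.
rewrite (bigD1 (k, o0)) /=; last by rewrite in_setX kP HQ.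
by rewrite /graph_entry /= lt_k Hc lt_ik ltn_eqF // -addnA leq_addr.
Qed.

Lemma violation_independent P Q beta : admissible P Q beta ->
  ~ PQ_inequality P Q beta (fraction_point graph_num graph_den) ->
  exists2 I, independent I & K <= #|I|.
Proof.
case=> -[P1 Q1] [P2 Q2] PQ3 beta2.
rewrite graph_inequality; last by lia.
move/negP; rewrite -ltnNge graph_diag.
case: ifP => HQ; last by rewrite muln0.
set I := [set i in P | i < N] => Hlt.
have le_I : #|I| <= #|P| by apply: subset_leq_card; apply/subsetP => i; rewrite inE => /andP[].
have leP : #|P| <= n by rewrite -[X in _ <= X](card_ord n) max_card.
have Hind (i k : 'I_n) : i \in I -> k \in I -> i < k -> ~~ conf i k.
  rewrite !inE => /andP[iP iN] /andP[kP kN] lt_ik; apply/negP => Hc.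
  have HB := graph_conflict HQ iP kP lt_ik kN Hc.
  (* Both [beta.-1] and |I| are at most n, so a single conflict, of weight n^2, already restores the
     inequality. *)
  have : 2 * beta.-1 * #|I| <= 2 * (n * n).
    rewrite -mulnA leq_mul2l /= leq_mul ?(leq_trans le_I) //.
    by apply: leq_trans leP; move: P1; clear; move: #|P| => m; lia.
  by move: Hlt HB; move: (B P Q) (n * n) (2 * beta.-1 * #|I|)
    (beta * beta.-1 * K.-1) => b a d e; lia.
exists I; first by split=> // i; rewrite inE => /andP[].
have {Hlt} : beta * beta.-1 * K.-1 < 2 * beta.-1 * #|I|.
  by apply: leq_ltn_trans Hlt; rewrite leq_addl.
rewrite (mulnC beta) (mulnC 2) -!mulnA ltn_mul2l => /andP[_].
(* What remains is beta (K-1) < 2|I|; with beta >= 2 it gives K - 1 < |I|. *)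
have : 2 * K.-1 <= beta * K.-1 by rewrite leq_mul2r beta2 orbT.
lia.
Qed.

Lemma independent_violation I : independent I -> K <= #|I| ->
  exists P Q beta, admissible P Q beta /\
    ~ PQ_inequality P Q beta (fraction_point graph_num graph_den).
Proof.
move=> [I_lt Hind] KI.
have le_I : #|I| <= N.
  rewrite cardE -(size_map val) -[X in _ <= X](size_iota 0).
  apply: uniq_leq_size; first by rewrite map_inj_uniq ?enum_uniq //; exact: val_inj.
  by move=> y /mapP[i]; rewrite mem_enum => /I_lt lt_i ->; rewrite mem_iota.
have lt1 : 1 < n by rewrite /n; lia.
have lt2 : 2 < n by rewrite /n; lia.
pose Q := o0 |: (Ordinal lt1 |: [set Ordinal lt2]).
have cQ : #|Q| = 3.
  by rewrite /Q !cardsU1 cards1 !inE.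
(* With beta = 2 and no conflict, the violated inequality amounts to 2|I| > 2(K-1). *)
exists I, Q, 2; split.
  rewrite /admissible cQ; move: le_I KI; move: #|I| => m le_m KI.
  by split; rewrite /n; lia.
rewrite graph_inequality // => /idP; apply/negP; rewrite -ltnNge graph_diag.
rewrite !inE eqxx /=.
have -> : [set i in I | i < N] = I.
  by apply/setP => i; rewrite inE andb_idr // => /I_lt.
have -> : B I Q = 0; last by move: KI; move: #|I| => m; lia.
rewrite /B big1 // => p; rewrite inE => /andP[pI _]; rewrite big1 // => q.
rewrite inE => /andP[/andP[qI _] lt_pq].
rewrite /graph_entry /= (ltn_eqF lt_pq) lt_pq (negPf (Hind _ _ pI qI lt_pq)) andbF.
by case: ifP.
Qed.

Lemma graph_reduction :
  PQ_language (encode_point graph_num graph_den) <->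
  ~ exists2 I, independent I & K <= #|I|.
Proof.
have den_gt0 p q : 0 < graph_den p q by rewrite /graph_den; lia.
have num_ge0 p q : (0 <= graph_num p q)%R by [].
split=> [HL [I indI /(independent_violation indI)[P [Q [beta [adm nineq]]]]]|].
  (* Membership only provides some point with this encoding; soundness of the verifier makes the
     argument independent of which one. *)
  have [u [_ /verify_sound]] := violation_not_PQ den_gt0 num_ge0 adm nineq.
  by apply.
move=> noI; exists n, graph_num, graph_den; split=> // [p q|P Q beta adm].
  by rewrite fraction_ge0.
by apply: NNPP => /(violation_independent adm).
Qed.
End GraphPoint.

(** * From accepting runs to tilings *)

Section Cells.
Variable E : finType.
Implicit Types (tp : tape E) (s : seq (symbol E)).

Definition cell tp (c y : nat) : symbol E :=
  if y < c then nth None (tape_left tp) (c - y).-1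
  else nth None (tape_right tp) (y - c).

Lemma cell_head tp c : cell tp c c = tape_read tp.
Proof. by rewrite /cell ltnn subnn nth0. Qed.

(** The head stays at c and the tape slides beneath it, opposite to the move. *)
Lemma cell_move tp a dir c y :
  let post z := if z == c then a else cell tp c z in
  cell (tape_move (tape_write tp a) dir) c y.+1 =
  match dir with
  | MoveLeft => post y
  | Stay => post y.+1
  | MoveRight => post y.+2
  end.
Proof.
case: tp => l r; case: dir; rewrite /cell /=.
- case: (ltngtP y.+1 c) => [lt_yc|gt_yc|eq_yc].
  + rewrite ltn_eqF ?(ltnW lt_yc) // nth_behead; congr nth; lia.
  + have -> : y.+1 - c = (y - c).+1 by lia.
    rewrite /=; case: (ltngtP y c) => [|lt_cy|->]; [by lia| |by rewrite subnn].
    have -> : y - c = (y - c).-1.+1 by lia.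
    by rewrite /= nth_behead.
  + by rewrite -eq_yc subnn ltn_eqF // subSnn nth0.
- case: (ltnP y.+1 c) => [lt_yc|le_cy].
  + case: (ltngtP y.+2 c) => [lt2|gt2|eq2]; [|by lia|].
    * have -> : (c - y.+1).-1 = (c - y.+2).-1.+1 by lia.
      by [].
    * by rewrite -eq2 subSnn.
  + rewrite gtn_eqF // ltnNge leqW //= nth_behead; congr nth; lia.
- case: (ltngtP y.+1 c) => // [lt_cy|->]; last by rewrite subnn.
  have -> : y.+1 - c = (y.+1 - c).-1.+1 by lia.
  by rewrite /= nth_behead.
Qed.

(** If blanks are never followed by bits, then the leading bits are the whole content, up to
    trailing blanks. This reads a certificate off a tiling. *)
Lemma leading_bits_persist s :
  (forall j, j < size s -> nth None s j = None \/
     exists b, nth None s j = Some (inl b)) ->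
  (forall j, j.+1 < size s -> nth None s j = None -> nth None s j.+1 = None) ->
  forall j, nth None s j = nth None [seq Some (inl b) | b <- leading_bits s] j.
Proof.
elim: s => [//|a s IH] Hb Hp j.
have [/= Ha|[b /= Ha]] := Hb 0 isT.
  rewrite Ha /= [RHS]nth_nil; elim: j => // j IHj.
  have [lt_j|le_j] := ltnP j.+1 (size (a :: s)).
    by move: (Hp _ lt_j); rewrite Ha; apply.
  exact: nth_default.
rewrite {}Ha /= in Hb Hp *; case: j => //= j.
by apply: IH => k lt_k; [exact: (Hb k.+1) | exact: (Hp k.+1)].
Qed.

Lemma size_leading_bits s : size (leading_bits s) <= size s.
Proof. by elim: s => //= -[[b|e]|] s IH. Qed.
End Cells.

Section Tableau.
Variable M : tm.

Definition column : finType := {ffun 'I_(tm_work M).+1 -> symbol (tm_extra M)}.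
(* Positions are relative to the heads, which all stay at position [T.+1].  A   *)
(* tile at [(t, z)] records the state and the scanned symbols at time [t], and *)
(* the contents of the positions [z], [z.+1] and [z.+2].                       *)
Definition tile : finType :=
  ((tm_state M * column) * (column * column * column))%type.

Implicit Types (v : tile) (a : column).

Definition tile_col v (o : nat) : column :=
  match o with 0 => v.2.1.1 | 1 => v.2.1.2 | _ => v.2.2 end.

Definition next_action (qr : tm_state M * column) :
    tm_state M * ('I_(tm_work M).+1 -> symbol (tm_extra M) * move) :=
  if tm_halt qr.1 then (qr.1, fun i => (qr.2 i, Stay)) else tm_delta qr.1 qr.2.

(** The middle column of the window one step later. The offset [o] of the head within the window
    tells which old column has been overwritten; 3 means that the head is outside. Each tape slides
    on its own. *)
Definition next_col (o : nat) v : column :=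
  [ffun i => let act := (next_action v.1).2 i in
    match act.2 with
    | MoveLeft => if o == 0 then act.1 else tile_col v 0 i
    | Stay => if o == 1 then act.1 else tile_col v 1 i
    | MoveRight => if o == 2 then act.1 else tile_col v 2 i
    end].

Definition blank_col a : bool := a == [ffun=> None].

Definition bit_col (b : bool) a : bool :=
  a == [ffun i => if i == ord0 then Some (inl b) else None].

Definition free_col a : bool := [|| blank_col a, bit_col true a | bit_col false a].

(** Row 0 carries the fixed input [d] from the head on, then Q positions left free for the
    certificate, and blanks elsewhere. *)
Definition init_ok (d : seq bool) (Q T y : nat) a : bool :=
  if y < T.+1 then blank_col a
  else if y < T.+1 + size d then
    (if nth false d (y - T.+1) then bit_col true a else bit_col false a)
  else if y < T.+1 + size d + Q then free_col a else blank_col a.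

Definition reads_center v : bool := v.1.2 == tile_col v 1.
Definition starting v : bool := v.1.1 == tm_start M.
Definition accepting v : bool := tile_col v 1 ord0 == Some (inl true).
Definition blank_persists v : bool :=
  blank_col (tile_col v 0) ==> blank_col (tile_col v 1).

Definition tile_ok (d : seq bool) (Q T t z : nat) v : bool :=
  [&& (t != 0) || [&& starting v, init_ok d Q T z (tile_col v 0)
                    & (z < T.+1 + size d) || blank_persists v],
      (z != T) || reads_center v
    & ((t != T) || (z != T)) || accepting v].

Definition same_global v v' : bool := v.1 == v'.1.
Definition overlap v v' : bool :=
  (tile_col v 1 == tile_col v' 0) && (tile_col v 2 == tile_col v' 1).
Definition vertical (o : nat) v v' : bool :=
  (v'.1.1 == (next_action v.1).1) && (tile_col v' 1 == next_col o v).

Definition vertical_at (T z : nat) v v' : bool :=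
  if z == T.+1 then vertical 0 v v' else if z == T then vertical 1 v v'
  else if z.+1 == T then vertical 2 v v' else vertical 3 v v'.

(** Every tile carries the state and scanned symbols of its row, and all tiles of a row must agree
    on them; this broadcasts the action of the machine to cells far from the head. *)
Definition tile_conflict (T : nat) (x y : nat * nat * tile) : bool :=
  ((x.1.1 == y.1.1) &&
     [|| (x.1.2 == y.1.2) && (x.2 != y.2), ~~ same_global x.2 y.2
       | (y.1.2 == x.1.2.+1) && ~~ overlap x.2 y.2])
  || [&& y.1.1 == x.1.1.+1, x.1.2 == y.1.2
       & ~~ vertical_at T x.1.2 x.2 y.2].

Definition row_width (T : nat) := 2 * T + 3.

Definition satisfies (d : seq bool) (Q T : nat) (A : nat -> nat -> tile) :=
  (forall t z, t <= T -> z < row_width T -> tile_ok d Q T t z (A t z)) /\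
  (forall t z t' z', t <= T -> z < row_width T -> t' <= T -> z' < row_width T ->
     ~~ tile_conflict T (t, z, A t z) (t', z', A t' z')).

(** * Accepting runs and tilings determine each other *)

Section Run.
Variables (d u : seq bool) (Q T : nat).
Let c := T.+1.

Definition run_config t := iter t (@tm_step M) (tm_init M (d ++ u)).

Arguments run_config t : simpl never.

Definition run_col t y : column := [ffun i => cell ((run_config t).2 i) c y].

Definition run_tile t z : tile :=
  (((run_config t).1, run_col t c), (run_col t z, run_col t z.+1, run_col t z.+2)).

Lemma run_reads t : [ffun i => tape_read ((run_config t).2 i)] = run_col t c.
Proof. by apply/ffunP => i; rewrite !ffunE cell_head. Qed.

Lemma run_tile_next t z : vertical_at T z (run_tile t z) (run_tile t.+1 z).
Proof.
suff H o : (o == 0) = (z == c) -> (o == 1) = (z.+1 == c) ->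
    (o == 2) = (z.+2 == c) -> vertical o (run_tile t z) (run_tile t.+1 z).
  rewrite /vertical_at; case: eqP => [e|/eqP n0].
    by apply: H; rewrite /c; lia.
  case: eqP => [e|/eqP n1]; first by apply: H; rewrite /c; lia.
  case: eqP => [e|/eqP n2]; first by apply: H; rewrite /c; lia.
  by apply: H; rewrite /c; lia.
move=> e0 e1 e2.
have -> : run_tile t.+1 z = ((tm_step (run_config t)).1, run_col t.+1 c,
  (run_col t.+1 z, run_col t.+1 z.+1, run_col t.+1 z.+2)) by [].
rewrite /vertical /next_action /tm_step /= run_reads.
case Hh: (tm_halt _); rewrite /= ?eqxx /=.
  apply/eqP/ffunP => i; rewrite !ffunE /next_action /= Hh /= e1.
  have -> : run_config t.+1 = run_config t by rewrite /run_config /= /tm_step Hh.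
  by case: eqP => [e|_]; rewrite ?ffunE ?e.
apply/eqP/ffunP => i; rewrite !ffunE /= /next_action /= Hh.
have -> : (run_config t.+1).2 i =
  let act := (tm_delta (run_config t).1 (run_col t c)).2 i in
  tape_move (tape_write ((run_config t).2 i) act.1) act.2.
  by rewrite /run_config /= {1}/tm_step Hh /= run_reads.
case: ((tm_delta _ _).2 i) => b dir /=; rewrite cell_move.
by case: dir => /=; rewrite ?e0 ?e1 ?e2 ?ffunE.
Qed.

Lemma run_col0 y : run_col 0 y = [ffun i => if (i == ord0) && (c <= y)
   then nth None [seq Some (inl b) | b <- d ++ u] (y - c) else None].
Proof.
apply/ffunP => i; rewrite !ffunE /cell /=.
by case: ltnP => _; rewrite ?andbF ?nth_nil ?andbT //; case: eqP; rewrite ?nth_nil.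
Qed.

Lemma run_col0_bit y b : c <= y -> y - c < size (d ++ u) ->
  nth false (d ++ u) (y - c) = b -> bit_col b (run_col 0 y).
Proof.
move=> le_cy lt_y <-; apply/eqP; rewrite run_col0; apply/ffunP => i.
by rewrite !ffunE le_cy andbT; case: eqP => // _; rewrite (nth_map false).
Qed.

Lemma run_col0_blank y : (y < c) || (c + size (d ++ u) <= y) ->
  blank_col (run_col 0 y).
Proof.
move=> H; apply/eqP; rewrite run_col0; apply/ffunP => i; rewrite !ffunE.
case: ifP => // /andP[_ le_cy]; rewrite nth_default // size_map.
by move: H; rewrite ltnNge le_cy /=; lia.
Qed.

Lemma run_satisfies : size u <= Q ->
  tape_read ((run_config T).2 ord0) = Some (inl true) ->
  satisfies d Q T run_tile.
Proof.
move=> le_u acc; split=> [t z le_t lt_z|t z t' z' _ _ _ _].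
  rewrite /tile_ok; apply/and3P; split.
  - case: t {le_t} => //= ; apply/and3P; split; first exact: eqxx.
      rewrite /init_ok -/c; case: ltnP => [lt_zc|le_cz].
        by apply: run_col0_blank; rewrite lt_zc.
      case: ltnP => [lt_d|le_d].
        set b := nth false d _.
        have : bit_col b (run_col 0 z).
          apply: run_col0_bit => //; first by rewrite size_cat; lia.
          by rewrite nth_cat; case: ltnP => //; lia.
        by case: b.
      have [lt_u|le_u'] := ltnP (z - c) (size (d ++ u)).
        have : free_col (run_col 0 z).
          have := @run_col0_bit z _ le_cz lt_u erefl.
          by rewrite /free_col; case: (nth _ _ _) => ->; rewrite ?orbT.
        case: ifP => // /negbT; rewrite -leqNgt => le_z _.
        by move: lt_u; rewrite size_cat; lia.
      have blk : blank_col (run_col 0 z) by apply: run_col0_blank; lia.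
      by case: ifP => // _; rewrite /free_col blk.
    rewrite -/c; case: ltnP => //= le_z; apply/implyP => blk.
    apply: run_col0_blank.
    rewrite leqNgt; apply/orP; right; apply/negP => lt_z'.
    have := @run_col0_bit z (nth false (d ++ u) (z - c)).
    have : z - c < size (d ++ u) by lia.
    move=> h1 /(_ _ h1 erefl) h2.
    have {}h2 : bit_col (nth false (d ++ u) (z - c)) (run_col 0 z).
      by apply: h2; lia.
    move/eqP: blk; rewrite /tile_col /= (eqP h2) => /ffunP/(_ ord0).
    by rewrite !ffunE eqxx.
  - by case: eqP => //= ->; exact: eqxx.
  - case: eqP => //= ->; case: eqP => //= ->.
    by rewrite /accepting /= ffunE cell_head acc.
rewrite /tile_conflict /= negb_or; apply/andP; split.
  apply/nandP; case: eqP => [<-|_]; [right | by left].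
  rewrite /same_global eqxx /= negb_or; apply/andP; split.
    by case: eqP => //= ->; rewrite eqxx.
  by case: eqP => //= ->; rewrite /overlap /= !eqxx.
case: eqP => //= ->; case: eqP => //= <-.
by rewrite run_tile_next.
Qed.
End Run.

(* Nothing constrains the positions beyond the ends of a row, so the tiles of  *)
(* row [t] are only known to agree with the run at distance [t] from the ends. *)
Lemma satisfies_run (d : seq bool) (Q T : nat) A :
  size d + Q <= T -> satisfies d Q T A ->
  exists2 u, size u <= Q &
    tape_read ((run_config d u T).2 ord0) = Some (inl true).
Proof.
move=> le_T [okA noconf]; set S := row_width T in okA noconf.
have SE : S = 2 * T + 3 by [].
pose c := T.+1; pose m := size d.
have ovl t z : t <= T -> z.+1 < S ->
    tile_col (A t z) 1 = tile_col (A t z.+1) 0 /\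
    tile_col (A t z) 2 = tile_col (A t z.+1) 1.
  move=> le_t lt_z; have := noconf t z t z.+1 le_t (ltnW lt_z) le_t lt_z.
  rewrite /tile_conflict /= !eqxx /= !negb_or => /andP[/and3P[_ _]].
  by rewrite negbK => /andP[/eqP e1 /eqP e2]; split; [exact: e1 | exact: e2].
have glob t z z' : t <= T -> z < S -> z' < S -> (A t z).1 = (A t z').1.
  move=> le_t lt_z lt_z'; have := noconf t z t z' le_t lt_z le_t lt_z'.
  rewrite /tile_conflict /= !eqxx /= !negb_or => /andP[/and3P[_]].
  by rewrite negbK => /eqP->.
have vert t z : t < T -> z < S -> vertical_at T z (A t z) (A t.+1 z).
  move=> lt_t lt_z; have := noconf t z t.+1 z (ltnW lt_t) lt_z lt_t lt_z.
  by rewrite /tile_conflict /= !eqxx /= negb_or negbK => /andP[].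
have ok0 z : z < S -> [/\ starting (A 0 z), init_ok d Q T z (tile_col (A 0 z) 0)
    & (z < T.+1 + size d) || blank_persists (A 0 z)].
  by move=> lt_z; have /and3P[/and3P] := okA 0 z isT lt_z.
(* The certificate consists of the leading bits in the free zone of row 0. *)
pose s := [seq tile_col (A 0 (c + m + j)) 0 ord0 | j <- iota 0 Q].
have size_s : size s = Q by rewrite size_map size_iota.
have nth_s j : j < Q -> nth None s j = tile_col (A 0 (c + m + j)) 0 ord0.
  by move=> lt_j; rewrite (nth_map 0) ?size_iota // nth_iota.
have free j : j < Q -> free_col (tile_col (A 0 (c + m + j)) 0).
  move=> lt_j; have lt_S : c + m + j < S by rewrite SE /c /m; lia.
  have [_ + _] := ok0 (c + m + j) lt_S.
  rewrite /init_ok -/c -/m ltnNge -addnA leq_addr /=.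
  by rewrite addnA ltnNge leq_addr /= ltn_add2l lt_j.
exists (leading_bits s); first by rewrite -size_s size_leading_bits.
set u := leading_bits s.
have sE : forall j, nth None s j = nth None [seq Some (inl b) | b <- u] j.
  apply: leading_bits_persist => j; rewrite size_s => lt_j.
    rewrite nth_s //; case/or3P: (free j lt_j) => /eqP->; rewrite ffunE.
    - by left.
    - by right; exists true.
    - by right; exists false.
  rewrite !nth_s ?(ltnW lt_j) // => blk.
  have lt_S : (c + m + j).+1 < S by rewrite SE /c /m; lia.
  have [_ _] := ok0 (c + m + j) (ltnW lt_S).
  rewrite -/c -/m ltnNge leq_addr /= => /implyP.
  have [-> _] := ovl 0 (c + m + j) isT lt_S => H.
  have -> : c + m + j.+1 = (c + m + j).+1 by rewrite addnS.
  suff /H/eqP/ffunP/(_ ord0) : blank_col (tile_col (A 0 (c + m + j)) 0).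
    by rewrite ffunE.
  case/or3P: (free j (ltnW lt_j)) => // /eqP e;
    by move: blk; rewrite e ffunE eqxx.
have col0 z : z < S -> tile_col (A 0 z) 0 = run_col d u T 0 z.
  move=> lt_z; have [_ + _] := ok0 z lt_z; rewrite /init_ok -/c -/m.
  case: ltnP => [lt_zc|le_cz].
    move/eqP->; apply/esym/eqP; apply: run_col0_blank; rewrite -/c lt_zc //.
  case: ltnP => [lt_d|le_d].
    have H : bit_col (nth false d (z - c)) (run_col d u T 0 z).
      apply: run_col0_bit => //; first by rewrite size_cat -/m -/c; lia.
      by rewrite nth_cat -/m -/c; case: ltnP => //; lia.
    by move: H; case: (nth _ _ _) => /eqP-> /eqP->.
  case: ltnP => [lt_Q|le_Q]; last first.
    move/eqP->; apply/esym/eqP; apply: run_col0_blank; rewrite -/c size_cat.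
    have : size u <= Q by rewrite -size_s size_leading_bits.
    by rewrite -/m; lia.
  move=> fr; apply/ffunP => i; rewrite run_col0 ffunE -/c le_cz andbT.
  case: eqP => [->|/eqP ne]; last first.
    by case/or3P: fr => /eqP->; rewrite ffunE // (negPf ne).
  have zE : z = c + m + (z - (c + m)) by lia.
  rewrite [in LHS]zE -nth_s ?sE; last by lia.
  rewrite map_cat nth_cat size_map -/m.
  by case: ltnP => [|_]; [lia | congr nth; lia].
have lt_TS : T < S by rewrite SE; lia.
(* The width 2T+3 is just enough for this region to contain, at time T, the cell z = T whose window
   is centred on the head. *)
have cone t z : t <= T -> t <= z -> z + t + 2 < S -> A t z = run_tile d u T t z.
  elim: t z => [|t IH] z le_t le_tz lt_z.
    have lt_zS : z < S by lia.
    have c0 : tile_col (A 0 z) 0 = run_col d u T 0 z by apply: col0; lia.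
    have c1 : tile_col (A 0 z) 1 = run_col d u T 0 z.+1.
      by rewrite (proj1 (ovl 0 z isT _)) ?col0 //; lia.
    have c2 : tile_col (A 0 z) 2 = run_col d u T 0 z.+2.
      rewrite (proj2 (ovl 0 z isT _)) ?(proj1 (ovl 0 z.+1 isT _)) ?col0 //; lia.
    have st : (A 0 z).1.1 = tm_start M.
      by have [/eqP] := ok0 z lt_zS.
    have rd : (A 0 z).1.2 = run_col d u T 0 c.
      rewrite (glob 0 z T isT lt_zS lt_TS).
      have /and3P[_ + _] := okA 0 T isT lt_TS; rewrite eqxx /= => /eqP->.
      by rewrite (proj1 (ovl 0 T isT _)) ?col0 //; lia.
    by case: (A 0 z) c0 c1 c2 st rd => -[q r] [[a0 a1] a2] /= -> -> -> -> ->.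
  (* The tile of A and the tile of the run both satisfy the vertical constraint above the same tile,
     which fixes the state and the middle column. The outer columns then come from the overlap with
     the two neighbours. *)
  have center y : t <= y -> y + t + 2 < S -> (A t.+1 y).1.1 = (run_config d u t.+1).1
      /\ tile_col (A t.+1 y) 1 = run_col d u T t.+1 y.+1.
    move=> le_ty lt_y.
    have lt_yS : y < S by lia.
    have := vert t y le_t lt_yS; rewrite (IH y) //; last exact: ltnW.
    have fin o : vertical o (run_tile d u T t y) (run_tile d u T t.+1 y) ->
        vertical o (run_tile d u T t y) (A t.+1 y) ->
        (A t.+1 y).1.1 = (run_config d u t.+1).1 /\
        tile_col (A t.+1 y) 1 = run_col d u T t.+1 y.+1.
      move=> /andP[/eqP e1 /eqP e2] /andP[/eqP e3 /eqP e4].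
      by split; [exact: etrans e3 (esym e1) | exact: etrans e4 (esym e2)].
    have := run_tile_next d u T t y; rewrite /vertical_at.
    case: ifP => _; first exact: fin.
    case: ifP => _; first exact: fin.
    by case: ifP => _; exact: fin.
  case: z le_tz lt_z => // z le_tz lt_z.
  have [||_ p0] := center z; [lia|lia|].
  have [||q1 p1] := center z.+1; [lia|lia|].
  have [||_ p2] := center z.+2; [lia|lia|].
  have c0 : tile_col (A t.+1 z.+1) 0 = run_col d u T t.+1 z.+1.
    by rewrite -(proj1 (ovl t.+1 z _ _)) ?p0 //; lia.
  have c2 : tile_col (A t.+1 z.+1) 2 = run_col d u T t.+1 z.+3.
    by rewrite (proj2 (ovl t.+1 z.+1 _ _)) ?p2 //; lia.
  have rd : (A t.+1 z.+1).1.2 = run_col d u T t.+1 c.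
    have lt_zS : z.+1 < S by lia.
    rewrite (glob t.+1 z.+1 T le_t lt_zS lt_TS).
    have /and3P[_ + _] := okA t.+1 T le_t lt_TS; rewrite eqxx /= => /eqP->.
    by have [||_ ->] := center T; [lia|lia|].
  by case: (A t.+1 z.+1) c0 p1 c2 q1 rd => -[q r] [[a0 a1] a2] /= -> -> -> -> ->.
have /and3P[_ _] := okA T T (leqnn _) lt_TS; rewrite !eqxx /= => /eqP.
by rewrite cone ?SE //= ?ffunE ?cell_head //; lia.
Qed.

Theorem tableauP (d : seq bool) (Q T : nat) : size d + Q <= T ->
  (exists A, satisfies d Q T A) <->
  exists u, size u <= Q /\
    tape_read ((iter T (@tm_step M) (tm_init M (d ++ u))).2 ord0) =
    Some (inl true).
Proof.
move=> le_T; split=> [[A /(satisfies_run le_T)[u le_u acc]]|[u [le_u acc]]].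
  by exists u.
by exists (run_tile d u T); exact: run_satisfies.
Qed.
End Tableau.

(** * The reduction *)

Lemma horner_nat_leq (p : {poly nat}) (a b : nat) :
  a <= b -> p.[a]%R <= p.[b]%R.
Proof.
move=> le_ab; rewrite /horner; elim: (polyseq p) => //= c s IH.
by apply: leq_add => //; apply: leq_mul.
Qed.

Lemma pt_horner X (eX : encodable X) (p : {poly nat}) (f : X -> nat) :
  polyf f -> polyf (fun x => p.[f x]%R).
Proof.
move=> Hf; rewrite /horner; elim: (polyseq p) => [|a s IH] /=.
  exact: polyf_const.
apply: (@polyf_ext _ _ _ _ (fun x => horner_rec s (f x) * f x + a)) => //.
by pt.
Qed.

Section Reduction.
Variable M : tm.

#[local] Instance enc_tile : encodable (tile M) := fun v => unary (enum_rank v).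

Definition vertex : Type := (nat * nat * tile M)%type.

(** M is fixed, so any predicate on tiles is a lookup in a constant table. *)
Lemma pt_tile1 X (eX : encodable X) (g : tile M -> bool) (f : X -> tile M) :
  polyf f -> polyf (fun x => g (f x)).
Proof.
move=> Hf.
have Hr : polyf (fun x => nat_of_ord (enum_rank (f x))).
  by apply: (polyf_comp Hf (g := fun v => nat_of_ord (enum_rank v)));
    exact: polyf_retype.
apply: polyf_ext (pt_nth false (polyf_const [seq g v | v <- enum (tile M)]) Hr).
by move=> x; rewrite (nth_map (f x)) ?nth_enum_rank // -cardE ltn_ord.
Qed.

Lemma pt_tile2 X (eX : encodable X) (g : tile M -> tile M -> bool)
    (f h : X -> tile M) :
  polyf f -> polyf h -> polyf (fun x => g (f x) (h x)).
Proof.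
move=> Hf Hh.
have Hr (k : X -> tile M) : polyf k -> polyf (fun x => nat_of_ord (enum_rank (k x))).
  by move=> Hk; apply: (polyf_comp Hk (g := fun v => nat_of_ord (enum_rank v)));
    exact: polyf_retype.
apply: polyf_ext (pt_nth false (pt_nth [::] (polyf_const
  [seq [seq g v v' | v' <- enum (tile M)] | v <- enum (tile M)]) (Hr _ Hf))
  (Hr _ Hh)) => x.
rewrite (nth_map (f x)) ?nth_enum_rank -?cardE ?ltn_ord //.
by rewrite (nth_map (f x)) ?nth_enum_rank // -cardE ltn_ord.
Qed.

Definition tile0 : tile M :=
  (tm_start M, [ffun=> None], ([ffun=> None], [ffun=> None], [ffun=> None])).
Definition vertex0 : vertex := (0, 0, tile0).

Definition all_vertices (T : nat) : seq vertex :=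
  [seq (tz, v) | tz <- [seq (t, z) | t <- iota 0 T.+1, z <- iota 0 (row_width T)],
                 v <- enum (tile M)].

Definition vertices (d : seq bool) (Q T : nat) : seq vertex :=
  [seq x : vertex <- all_vertices T | tile_ok d Q T x.1.1 x.1.2 x.2].

(** Symmetrised, because the graph only looks at pairs i < k whereas [tile_conflict] is oriented. *)
Definition conflict (T : nat) (VL : seq vertex) (i k : nat) : bool :=
  tile_conflict T (nth vertex0 VL i) (nth vertex0 VL k)
  || tile_conflict T (nth vertex0 VL k) (nth vertex0 VL i).

Definition tile_count (T : nat) : nat := T.+1 * row_width T.

Definition graph_word (T : nat) (VL : seq vertex) : seq bool :=
  delimit (bits (size VL + 4)) ++
  flatten [seq encode_entry
             (bits (graph_entry (size VL) (conflict T VL) pq.1 pq.2),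
              bits (tile_count T).-1)
          | pq <- quad_index (size VL + 4)].

Lemma graph_wordE T VL :
  encode_point (@graph_num (size VL) (conflict T VL))
               (@graph_den (size VL) (tile_count T)) = graph_word T VL.
Proof.
by rewrite encode_pointE // /graph_word quad_indexE -!map_comp.
Qed.

Lemma mem_vertices d Q T (t z : nat) (v : tile M) :
  ((t, z, v) \in vertices d Q T) =
  [&& t <= T, z < row_width T & tile_ok d Q T t z v].
Proof.
rewrite mem_filter /= andbC andbA; congr (_ && _).
rewrite /all_vertices; apply/idP/andP => [|[le_t lt_z]].
  case/allpairsP => tzv [Htz _ e].
  have {e} e : tzv.1 = (t, z) by case: e.
  move: Htz; rewrite e.
  case/allpairsP => tz [h1 h2 {}e].
  have [-> ->] : t = tz.1 /\ z = tz.2 by case: e.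
  by move: h1 h2; rewrite !mem_iota !add0n ltnS.
apply/allpairsP; exists ((t, z), v); rewrite mem_enum; split=> //.
by apply/allpairsP; exists (t, z); rewrite !mem_iota.
Qed.

Lemma uniq_vertices d Q T : uniq (vertices d Q T).
Proof.
apply: filter_uniq; apply: allpairs_uniq; last by move=> [? ?] [? ?].
  by apply: allpairs_uniq; rewrite ?iota_uniq // => -[? ?] [? ?].
exact: enum_uniq.
Qed.

Lemma tile_conflict_refl T (x : vertex) : tile_conflict T x x = false.
Proof.
by rewrite /tile_conflict /same_global !eqxx /= !(ltn_eqF (ltnSn _)).
Qed.

(** An independent set has at most one vertex per cell, so reaching the number of cells means having
    exactly one tile in each. *)
Lemma independent_satisfies d Q T : let VL := vertices d Q T in
  (exists2 I, independent (N := size VL) (conflict T VL) I & tile_count T <= #|I|)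
  <-> exists A, satisfies (M := M) d Q T A.
Proof.
set VL := vertices d Q T => /=; set N := size VL; set W := row_width T.
pose x (i : nat) := nth vertex0 VL i.
have xVL i : i < N -> x i \in VL by exact: mem_nth.
have rng i : i < N -> [&& (x i).1.1 <= T, (x i).1.2 < W
    & tile_ok d Q T (x i).1.1 (x i).1.2 (x i).2].
  by move=> /xVL; case: (x i) => -[t z] v; rewrite mem_vertices.
split=> [[I [I_lt Hind] le_I]|[A [okA noconf]]].
  have nocf i k : i \in I -> k \in I -> ~~ tile_conflict T (x i) (x k).
    move=> iI kI; case: (ltngtP i k) => [lt_ik|lt_ki|->].
    - by have := Hind _ _ iI kI lt_ik; rewrite /conflict negb_or => /andP[].
    - by have := Hind _ _ kI iI lt_ki; rewrite /conflict negb_or => /andP[].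
    - by rewrite tile_conflict_refl.
  have W_gt0 : W = W.-1.+1 by rewrite /W /row_width; lia.
  pose phi (i : 'I_(N + 4)) : 'I_T.+1 * 'I_W.-1.+1 :=
    (inord (x i).1.1, inord (x i).1.2).
  have phi_inj : {in I &, injective phi}.
    move=> i k iI kI [] /(congr1 val) + /(congr1 val).
    have /and3P[ti zi _] := rng _ (I_lt _ iI).
    have /and3P[tk zk _] := rng _ (I_lt _ kI).
    rewrite /= !inordK -?W_gt0 // => et ez; apply: val_inj.
    apply/eqP; rewrite -(nth_uniq vertex0 _ _ (uniq_vertices d Q T)) ?I_lt //.
    have := nocf i k iI kI; rewrite -/(x i) -/(x k).
    rewrite /tile_conflict et ez !eqxx /= !negb_or => /andP[/andP[+ _] _].
    rewrite negbK => /eqP ev; apply/eqP.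
    by move: et ez ev; case: (x i) => -[? ?] ?; case: (x k) => -[? ?] ? /= -> -> ->.
  (* An injection from a set of at least K elements into the K cells is onto. *)
  have phi_full : phi @: I = setT.
    apply/eqP; rewrite eqEcard subsetT cardsT card_prod !card_ord card_in_imset //.
    by rewrite -W_gt0.
  have ex t z : t <= T -> z < W -> exists2 i : 'I_(N + 4), i \in I & (x i).1 = (t, z).
    move=> le_t lt_z.
    have : (inord t, inord z) \in phi @: I by rewrite phi_full inE.
    case/imsetP => i iI [] /(congr1 val) + /(congr1 val).
    have /and3P[ti zi _] := rng _ (I_lt _ iI).
    rewrite /= !inordK -?W_gt0 // => -> ->; exists i => //.
    exact: surjective_pairing.
  pose A t z : tile M :=
    if [pick i in I | (x i).1 == (t, z)] is Some i then (x i).2 else tile0.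
  have AE t z : t <= T -> z < W ->
      exists2 i : 'I_(N + 4), i \in I & x i = (t, z, A t z).
    move=> le_t lt_z; rewrite /A; case: pickP => [i /andP[iI /eqP e]|none].
      by exists i => //; rewrite -e -surjective_pairing.
    have [i iI e] := ex t z le_t lt_z.
    by have := none i; rewrite iI e eqxx.
  exists A; split=> [t z le_t lt_z|t z t' z' le_t lt_z le_t' lt_z'].
    have [i iI e] := AE t z le_t lt_z.
    by have /and3P[_ _] := rng _ (I_lt _ iI); rewrite e.
  have [i iI e] := AE t z le_t lt_z; have [k kI e'] := AE t' z' le_t' lt_z'.
  by rewrite -e -e'; exact: nocf.
(* Conversely, keep the vertices that the tiling uses; [psi] below embeds the cells into them. *)
pose I := [set i : 'I_(N + 4) | (i < N) && ((x i).2 == A (x i).1.1 (x i).1.2)].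
have inI i : i \in I -> i < N /\ x i = ((x i).1.1, (x i).1.2, A (x i).1.1 (x i).1.2).
  rewrite inE => /andP[lt_i /eqP <-]; split=> //.
  by case: (x i) => -[].
exists I.
  split=> [i /inI[]//|i k /inI[lt_i ei] /inI[lt_k ek] _].
  rewrite /conflict -/(x i) -/(x k) negb_or ei ek.
  have /and3P[ti zi _] := rng _ lt_i; have /and3P[tk zk _] := rng _ lt_k.
  by rewrite !noconf.
have idx_lt (y : vertex) : index y VL < N + 4.
  by apply: leq_ltn_trans (index_size _ _) _; rewrite -/N; lia.
pose psi (tz : 'I_T.+1 * 'I_W) : 'I_(N + 4) :=
  Ordinal (idx_lt (val tz.1, val tz.2, A tz.1 tz.2)).
have inVL (tz : 'I_T.+1 * 'I_W) : (val tz.1, val tz.2, A tz.1 tz.2) \in VL.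
  have le_t : val tz.1 <= T by have := ltn_ord tz.1; rewrite ltnS.
  have lt_z : val tz.2 < W := ltn_ord tz.2.
  by rewrite mem_vertices le_t lt_z; exact: okA.
have xpsi tz : x (psi tz) = (val tz.1, val tz.2, A tz.1 tz.2).
  exact: (nth_index vertex0 (inVL tz)).
have psi_inj : injective psi.
  move=> a b e; have := etrans (esym (xpsi a)) (etrans
    (congr1 (fun i : 'I_(N + 4) => x i) e) (xpsi b)).
  by case: a b {e} => a1 a2 [b1 b2] [] /= /val_inj-> /val_inj-> _.
have -> : tile_count T = #|[set psi tz | tz in [set: 'I_T.+1 * 'I_W]]|.
  by rewrite card_imset // cardsT card_prod !card_ord.
apply: subset_leq_card; apply/subsetP => _ /imsetP[tz _ ->].
by rewrite inE xpsi eqxx andbT /= index_mem; exact: inVL.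
Qed.

Ltac pt_extra ::=
  match goal with
  | |- polyf (fun x => bits (@?f x)) => apply: (pt_bits (n := f))
  | |- polyf (fun x => horner _ (@?f x)) => apply: (pt_horner _ (f := f))
  | |- polyf (fun x => starting (@?f x)) => apply: (pt_tile1 (@starting M) (f := f))
  | |- polyf (fun x => reads_center (@?f x)) =>
      apply: (pt_tile1 (@reads_center M) (f := f))
  | |- polyf (fun x => accepting (@?f x)) => apply: (pt_tile1 (@accepting M) (f := f))
  | |- polyf (fun x => blank_persists (@?f x)) =>
      apply: (pt_tile1 (@blank_persists M) (f := f))
  | |- polyf (fun x => blank_col (tile_col (@?f x) 0)) =>
      apply: (pt_tile1 (fun v : tile M => blank_col (tile_col v 0)) (f := f))
  | |- polyf (fun x => free_col (tile_col (@?f x) 0)) =>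
      apply: (pt_tile1 (fun v : tile M => free_col (tile_col v 0)) (f := f))
  | |- polyf (fun x => bit_col ?b (tile_col (@?f x) 0)) =>
      apply: (pt_tile1 (fun v : tile M => bit_col b (tile_col v 0)) (f := f))
  | |- polyf (fun x => same_global (@?f x) (@?g x)) =>
      apply: (pt_tile2 (@same_global M) (f := f) (h := g))
  | |- polyf (fun x => overlap (@?f x) (@?g x)) =>
      apply: (pt_tile2 (@overlap M) (f := f) (h := g))
  | |- polyf (fun x => vertical ?o (@?f x) (@?g x)) =>
      apply: (pt_tile2 (@vertical M o) (f := f) (h := g))
  | |- polyf (fun x => @eq_op _ (@?f x) (@?g x)) =>
      apply: (pt_tile2 (@eq_op (tile M)) (f := f) (h := g))
  | |- polyf (fun x => delimit (@?f x)) => rewrite /delimit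
  end.

Lemma polyf_tile_conflict :
  polyf (fun p : nat * vertex * vertex => tile_conflict p.1.1 p.1.2 p.2).
Proof. by rewrite /tile_conflict /vertical_at; pt. Qed.

Lemma polyf_vertices :
  polyf (fun p : seq bool * nat * nat => vertices p.1.1 p.1.2 p.2).
Proof.
rewrite /vertices /all_vertices /tile_ok /init_ok /row_width; pt.
Qed.

Lemma polyf_graph_word :
  polyf (fun p : nat * seq vertex => graph_word p.1 p.2).
Proof.
pose X := ((nat * seq vertex) * ((nat * nat) * (nat * nat)))%type.
have Hc (f g : X -> nat) : polyf f -> polyf g ->
    polyf (fun p : X => conflict p.1.1 p.1.2 (f p) (g p)).
  move=> Hf Hg; rewrite /conflict.
  apply: pt_orb.
    apply: (polyf_comp (f := fun p : X => (p.1.1, nth vertex0 p.1.2 (f p),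
      nth vertex0 p.1.2 (g p))) _ polyf_tile_conflict); pt.
  apply: (polyf_comp (f := fun p : X => (p.1.1, nth vertex0 p.1.2 (g p),
      nth vertex0 p.1.2 (f p))) _ polyf_tile_conflict); pt.
have Hc' : polyf (fun p : X => conflict p.1.1 p.1.2 p.2.1.1 p.2.2.1).
  by apply: Hc; pt.
have Hq : polyf (fun p : nat * seq vertex => quad_index (size p.2 + 4)).
  by apply: (polyf_comp _ polyf_quad_index); pt.
rewrite /graph_word /encode_entry /graph_entry /tile_count /row_width; pt.
Qed.

(** * The reduction and its correctness *)

Variable q p : {poly nat}.

(** The first term lets M halt on every admissible certificate; the others give the hypothesis of
    [tableauP] that input and certificate fit within T. *)
Definition time_bound (w : seq bool) : nat :=
  p.[(size (delimit w) + q.[size w]%R)%N]%R + size (delimit w) + q.[size w]%R.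

Definition reduction (w : seq bool) : seq bool :=
  graph_word (time_bound w) (vertices (delimit w) q.[size w]%R (time_bound w)).

Lemma polyf_reduction : polyf reduction.
Proof.
have HT : polyf time_bound by rewrite /time_bound; pt.
have HV : polyf (fun w => vertices (delimit w) q.[size w]%R (time_bound w)).
  by apply: (polyf_comp (f := fun w => (delimit w, q.[size w]%R, time_bound w))
    _ polyf_vertices); pt.
by apply: (polyf_comp (f := fun w => (time_bound w, vertices (delimit w)
  q.[size w]%R (time_bound w))) _ polyf_graph_word); pt.
Qed.

Lemma reductionP (V : pred (seq bool)) :
  (forall w, let c := iter p.[size w]%R (@tm_step M) (tm_init M w) in
     tm_halt c.1 /\ tm_output c = [:: V w]) ->
  forall w, PQ_language (reduction w) <->
    ~ exists u, size u <= q.[size w]%R /\ V (delimit w ++ u).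
Proof.
move=> HV w; rewrite /reduction -graph_wordE.
set T := time_bound w; set Q := q.[size w]%R; set d := delimit w.
have le_T : size d + Q <= T by rewrite /T /time_bound -addnA leq_addl.
have K3 : 3 <= tile_count T by rewrite /tile_count /row_width; nia.
rewrite (@graph_reduction _ _ _ K3) independent_satisfies (tableauP _ le_T).
suff acc u : size u <= Q ->
    tape_read ((iter T (@tm_step M) (tm_init M (d ++ u))).2 ord0) =
      Some (inl true) <-> V (d ++ u).
  by split=> H [u [le_u Hu]]; apply: H; exists u; split=> //; apply/(acc u).
move=> le_u; have [] := HV (d ++ u).
set c := iter _ _ _ => Hh Hout.
have le_p : p.[size (d ++ u)]%R <= T.
  apply: leq_trans (_ : p.[size d + Q]%R <= _); last first.
    by rewrite /T /time_bound -addnA leq_addr.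
  by apply: horner_nat_leq; rewrite size_cat leq_add2l.
rewrite -(subnK le_p) iterD -/c tm_halted //.
move: Hout; rewrite /tm_output /tape_read.
(* At time T the machine has halted with a one-bit output, so the scanned symbol of tape 0 is the
   verdict. *)
case: (tape_right _) => [//|[[b|e]|] r] //= [-> _].
by split=> [[->]|->].
Qed.
End Reduction.

Theorem theorem4 : coNP_complete PQ_language.
Proof.
split; first exact: PQ_in_coNP.
move=> L [V [q [[M [p HV]] HL]]].
exists (reduction M q p); split.
  by apply: polyf_polytime; exact: polyf_reduction.
move=> w; rewrite (reductionP q HV) -HL.
by split=> [Lw nLw|/NNPP].
Qed.
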